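(* Let $Q$ be the one-way quiver of type $A_n$, with vertices $s_1,\dots,s_n$ and arrows $a_i:s_i\to s_{i+1}$ for $1\le i\le n-1$, let $V_1,\dots,V_n$ be complex vector spaces of dimensions $d_1,\dots,d_n$, and let $\mathcal R_d=\bigoplus_{i=1}^{n-1}\mathrm{Hom}(V_i,V_{i+1})$. Let $k=(k_1,\dots,k_{n-1})$ and $t=(t_2,\dots,t_{n-1})$ be integer vectors, and let $\overline{\mathcal O}_{k,t}$ be the closure of the orbit $$\mathcal O_{k,t}=\{\phi\in\mathcal R_d:\ \dim\ker\phi_{a_i}=k_i\ (1\le i\le n-1),\ \dim(\mathrm{Im}\,\phi_{a_i}\cap\ker\phi_{a_{i+1}})=t_{i+1}\ (1\le i\le n-2)\}.$$ Assume $t_i\neq k_i$ for $2\le i\le n-1$. Then the resolution of singularities of $\overline{\mathcal O}_{k,t}$ defined by $W,F$ (see the context) is crepant if and only if there exists $r$ such that $$d_1=d_n=d_i-t_i\ \text{ for } 2\le i\le n-1\quad\text{and}\quad r=d_i-k_i\ \text{ for } 1\le i\le n-1.$$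
   Context: $\mathrm{Gr}(\alpha,V_i)$ is the Grassmannian of $\alpha$-dimensional subspaces of $V_i$, and $F(\alpha_1,\alpha_2,V_i)$ is the flag variety in $V_i$ with tautological bundles $\mathcal U_{i,1}\subset\mathcal U_{i,2}$ of ranks $\alpha_1,\alpha_2$. On $\mathrm{Gr}(k_1,V_1)$ the tautological bundle is denoted $\mathcal U_{1,1}$. Bundles are pulled back to products. The resolution of $\overline{\mathcal O}_{k,t}$ is the total space of the vector bundle $$W=((V_{n-1}/\mathcal U_{n-1,1})^*\otimes V_n)\oplus\bigoplus_{i=1}^{n-2}((V_i/\mathcal U_{i,1})^*\otimes\mathcal U_{i+1,2})$$ over $$F=\mathrm{Gr}(k_1,V_1)\times\prod_{i=2}^{n-1}F(k_i,\ d_{i-1}-k_{i-1}+k_i-t_i,\ V_i),$$ viewed as a subbundle of the trivial bundle $\mathcal R_d\times F$ and mapped to $\mathcal R_d$ by projection. The resolution is crepant if $\det(W)\cong K_F$ as line bundles on $F$ (equivalently, the total space of $W$ has trivial canonical bundle).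
   Formalization: ''Crepant ⇒ condition'' is proved assuming 0<k_1<d_1 and, with b_i=d_{i-1}-k_{i-1}+k_i-t_i for 2≤i≤n-1, k_i<b_i and (b_i<d_i or t_i=0); without this it fails, e.g. n=2, d=(1,2), k_1=0. O_{k,t} is assumed non-empty; the converse needs no more. *)

(* Defs.v *)
From HB Require Import structures.
From mathcomp Require Import all_boot all_order all_algebra.
From mathcomp Require Import complex mxtens.
From mathcomp Require Import all_classical all_reals all_analysis.
From mathcomp Require mpoly.
Import numFieldNormedType.Exports.
Import GRing.Theory.

Set Implicit Arguments.
Unset Strict Implicit.
Unset Printing Implicit Defensive.

Local Open Scope classical_set_scope.
Local Open Scope ring_scope.

(** A smooth variety given by its points and an atlas of charts, each of them
    a parametrization of an open subset by a whole affine space K^N. *)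
Record atlas (K : numFieldType) := Atlas {
  ambient : Type;
  points : set ambient;
  adim : nat;
  chart_index : Type;
  chart : chart_index -> 'rV[K]_adim -> ambient }.

Section Bundles.
Context (K : numFieldType) (X : atlas K).

Definition in_chart (a : chart_index X) : set (ambient X) := range (chart a).

Definition local_coord (a : chart_index X) (u : ambient X) : 'rV[K]_(adim X) :=
  xget 0 [set z | chart a z = u].

(** A vector bundle of rank [r], trivialized by a frame [s^a] over every chart,
    is given by its transition matrices: if [u] lies in the charts [a] and [b],
    then [s^a_p(u) = \sum_q (E a b u) p q *: s^b_q(u)].  The values of [E a b]
    outside of the overlap of the two charts are irrelevant. *)
Definition bundle (r : nat) :=
  chart_index X -> chart_index X -> ambient X -> 'M[K]_r.

Definition line_bundle := chart_index X -> chart_index X -> ambient X -> K.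

Definition trivial_bundle r : bundle r := fun _ _ _ => 1%:M.

Definition dual_bundle r (E : bundle r) : bundle r :=
  fun a b u => (invmx (E a b u))^T.

Definition tensor_bundle r s (E : bundle r) (E' : bundle s) : bundle (r * s) :=
  fun a b u => E a b u *t E' a b u.

Definition sum_bundle r s (E : bundle r) (E' : bundle s) : bundle (r + s) :=
  fun a b u => block_mx (E a b u) 0 0 (E' a b u).

Definition bigsum_bundle n (r : 'I_n -> nat) (E : forall i, bundle (r i)) :
  bundle (\sum_i r i) := fun a b u => \mxdiag_i E i a b u.

Definition det_bundle r (E : bundle r) : line_bundle :=
  fun a b u => \det (E a b u).

(** The frame over the chart [a] is the one of the coordinate vector fields. *)
Definition tangent_bundle : bundle (adim X) := fun a b u =>
  jacobian (fun z => local_coord b (chart a z)) (local_coord a u).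

Definition canonical_bundle : line_bundle :=
  det_bundle (dual_bundle tangent_bundle).

Definition regular (f : 'rV[K]_(adim X) -> K) :=
  exists P : mpoly.mpoly (adim X) K, forall z, f z = mpoly.meval (z 0) P.

(** With [l^a], [m^a] the local frames of [L], [M], the isomorphism is
    [l^a |-> f a *: m^a]. *)
Definition line_bundle_iso (L M : line_bundle) :=
  exists f : chart_index X -> 'rV[K]_(adim X) -> K,
    (forall a, regular (f a) /\ (forall z, f a z != 0)) /\
    (forall a b u, points u -> in_chart a u -> in_chart b u ->
       f a (local_coord a u) * M a b u = L a b u * f b (local_coord b u)).

End Bundles.

(** Vertices are numbered from 1 to [n = m.+2]; only the components
    [V 1, ..., V m.+2] of [V] matter, and likewise for [k], [t] and for the
    components [phi 1, ..., phi m.+1] of a representation. *)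
Section Quiver.
Context (K : numFieldType) (V : nat -> vectType K).

Definition rep := forall i, 'Hom(V i, V i.+1).

Definition orbit_kt (n : nat) (k t : nat -> nat) : set rep :=
  [set phi |
    (forall i, 1 <= i <= n - 1 -> \dim (lker (phi i)) = k i)%N /\
    (forall i, 1 <= i <= n - 2 ->
       \dim (limg (phi i) :&: lker (phi i.+1))%VS = t i.+1)%N].

Definition vdim (i : nat) : nat := \dim {:V i}.

End Quiver.

Section FlagVariety.
Context (K : numFieldType) (m : nat) (V : nat -> vectType K) (k t : nat -> nat).

Local Notation d := (vdim V).

(** Rank of [U_{i,2}].  For [i = 1] it is [d_1]: [Gr(k_1,V_1)] is
    [F(k_1,d_1,V_1)]. *)
Definition rank2 (i : nat) : nat :=
  (if i == 1 then d 1 else d (i - 1) - k (i - 1) + k i - t i)%N.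

(** The factors of [F] are indexed by [i : 'I_m.+1], the one with index [i]
    being at the vertex [i.+1]; [u i] is the pair [(U_{i.+1,1}, U_{i.+1,2})]. *)
Definition flags := forall i : 'I_m.+1, ({vspace V i.+1} * {vspace V i.+1})%type.

Definition is_flag : set flags := [set u | forall i : 'I_m.+1,
  [/\ ((u i).1 <= (u i).2)%VS, \dim (u i).1 = k i.+1
    & \dim (u i).2 = rank2 i.+1]].

(** Which of the three blocks cut out of [{0,...,d_i-1}] at [k_i] and [rank2 i]
    contains [p]. *)
Definition block (i p : nat) : nat := ((k i <= p) + (rank2 i <= p))%N.

Definition position := {i : 'I_m.+1 & ('I_(d i.+1) * 'I_(d i.+1))%type}.

Definition Position (i : 'I_m.+1) (p q : 'I_(d i.+1)) : position :=
  Tagged (fun j : 'I_m.+1 => ('I_(d j.+1) * 'I_(d j.+1))%type) (p, q).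

(** Strictly block upper triangular positions. *)
Definition coord_index := {c : position |
  (block (tag c).+1 (tagged c).1 < block (tag c).+1 (tagged c).2)%N}.

Definition fdim : nat := #|{: coord_index}|.

Definition entry (z : 'rV[K]_fdim) (i : 'I_m.+1) (p q : 'I_(d i.+1)) : K :=
  if insub (Position p q) is Some c then z 0 (enum_rank (c : coord_index))
  else 0.

Definition bases :=
  {e : forall i : 'I_m.+1, (d i.+1).-tuple (V i.+1) |
     forall i, basis_of fullv (e i)}.

Definition flag_frame (e : bases) (z : 'rV[K]_fdim) (i : 'I_m.+1) :
    (d i.+1).-tuple (V i.+1) :=
  [tuple tnth (sval e i) p + \sum_q entry z p q *: tnth (sval e i) q
     | p < d i.+1].

(** The parametrization by block unipotent matrices of the big cell of the
    flags opposite to those spanned by the last vectors of the bases [e]. *)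
Definition flag_chart (e : bases) (z : 'rV[K]_fdim) : flags := fun i =>
  (<<take (k i.+1) (flag_frame e z i)>>%VS,
   <<take (rank2 i.+1) (flag_frame e z i)>>%VS).

Definition flag_variety : atlas K :=
  @Atlas K flags is_flag fdim bases flag_chart.

Local Notation F := flag_variety.

(** The frame of the trivial bundle [V_{i.+1}] over a chart that is adapted to
    [U_{i.+1,1}] and [U_{i.+1,2}], and its transition matrices. *)
Definition adapted_frame (i : 'I_m.+1) (a : bases) (u : flags) :
    (d i.+1).-tuple (V i.+1) :=
  flag_frame a (@local_coord K F a u) i.

Definition adapted (i : 'I_m.+1) : bundle F (d i.+1) := fun a b u =>
  \matrix_(p, q) coord (adapted_frame i b u) q (tnth (adapted_frame i a u) p).

Definition principal_submx r (P : pred 'I_r) (M : 'M[K]_r) : 'M[K]_#|P| :=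
  mxsub (@enum_val _ P) (@enum_val _ P) M.

(** [U_{i.+1,2}], framed by the first vectors of the adapted frame. *)
Definition taut2 (i : 'I_m.+1) : bundle F _ := fun a b u =>
  principal_submx (fun p => (p < rank2 i.+1)%N) (adapted i a b u).

(** [V_{i.+1} / U_{i.+1,1}], framed by the classes of the last vectors of the
    adapted frame. *)
Definition quot1 (i : 'I_m.+1) : bundle F _ := fun a b u =>
  principal_submx (fun p => (k i.+1 <= p)%N) (adapted i a b u).

(** The index of the vertex [i.+1] is [widen_ord (leqnSn m) i], that of the
    vertex [i.+2] is [lift ord0 i], and that of the vertex [n - 1] is
    [ord_max]. *)
Definition Wbundle : bundle F _ :=
  sum_bundle
    (tensor_bundle (dual_bundle (quot1 ord_max))
                   (trivial_bundle (X := F) (d m.+2)))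
    (bigsum_bundle (fun i : 'I_m =>
       tensor_bundle (dual_bundle (quot1 (widen_ord (leqnSn m) i)))
                     (taut2 (lift ord0 i)))).

Definition crepant :=
  line_bundle_iso (det_bundle Wbundle) (canonical_bundle (X := F)).

End FlagVariety.

(** The charts parametrize subsets of [is_flag] injectively and cover it. *)
Section FlagAtlas.
Context (K : numFieldType) (m : nat) (V : nat -> vectType K) (k t : nat -> nat).
Local Notation d := (vdim V).
Local Notation rank2 := (rank2 V k t).
Context (dims : forall i : 'I_m.+1, (k i.+1 <= rank2 i.+1 <= d i.+1)%N).
Implicit Types (e : bases m V) (z : 'rV[K]_(fdim m V k t)).

Lemma tnth_flag_frame e z i p : tnth (flag_frame e z i) p =
  tnth (sval e i) p + \sum_q entry z p q *: tnth (sval e i) q.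
Proof. exact: tnth_mktuple. Qed.
Local Opaque flag_frame.

Lemma entry_eq0 z (i : 'I_m.+1) (p q : 'I_(d i.+1)) :
  (block V k t i.+1 q <= block V k t i.+1 p)%N -> entry z p q = 0.
Proof.
move=> h; rewrite /entry; case: insubP => //= c; rewrite /Position /= => + _.
by rewrite ltnNge h.
Qed.

Lemma entryE z (c : coord_index m V k t) :
  entry z (tagged (val c)).1 (tagged (val c)).2 = z 0 (enum_rank c).
Proof.
rewrite /entry (_ : Position _ _ = val c); last by case: c => -[i [p q]].
by rewrite valK.
Qed.

Lemma block_le i p q : (p <= q)%N -> (block V k t i p <= block V k t i q)%N.
Proof.
move=> pq; rewrite /block leq_add //.
  by case: (leqP (k i) p) => // /leq_trans/(_ pq) ->.
by case: (leqP (rank2 i) p) => // /leq_trans/(_ pq) ->.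
Qed.

Lemma coord_frame e z i p q :
  coord (sval e i) q (tnth (flag_frame e z i) p) = (p == q)%:R + entry z p q.
Proof.
have eF := basis_free (svalP e i).
rewrite tnth_flag_frame linearD linear_sum /= (tnth_nth 0) coord_free //.
rewrite (bigD1 q) //= linearZ /= (tnth_nth 0) coord_free // eqxx mulr1 big1 ?addr0 //.
by move=> j jq; rewrite linearZ /= (tnth_nth 0) coord_free // (_ : (j == q) = false) ?mulr0 //; exact: negbTE.
Qed.

Lemma flag_frame_free e z i : free (flag_frame e z i).
Proof.
apply/freeP => c c0.
have H (q : 'I_(d i.+1)) : c q + \sum_(p < d i.+1 | (p < q)%N) c p * entry z p q = 0.
  have := congr1 (coord (sval e i) q) c0; rewrite linear0 linear_sum /= => H0; rewrite -[RHS]H0.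
  rewrite [RHS](bigD1 q) //= linearZ /= -(tnth_nth 0) coord_frame eqxx entry_eq0 // addr0 mulr1.
  congr (_ + _); rewrite [LHS]big_mkcond [RHS]big_mkcond; apply: eq_bigr => p _.
  rewrite linearZ /= -(tnth_nth 0) coord_frame -val_eqE /=.
  case: ltngtP => //= pq; rewrite ?add0r //.
  by rewrite entry_eq0 ?mulr0 // block_le // ltnW.
move=> q; have [n] := ubnP (q : nat); elim: n q => // n IH q /ltnSE qn.
have := H q; rewrite big1 ?addr0 // => p pq.
by rewrite IH ?mul0r // (leq_trans pq).
Qed.

Lemma flag_chart_points e z : is_flag k t (flag_chart e z).
Proof.
move=> i /=; have /andP[k1 k2] := dims i.
have fr := flag_frame_free e z i.
have dim_take j : (j <= d i.+1)%N -> \dim <<take j (flag_frame e z i)>> = j.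
  move=> jd; have /eqP -> : free (take j (flag_frame e z i)).
    by apply: (@catl_free _ _ (drop j (flag_frame e z i))); rewrite cat_take_drop.
  by rewrite size_takel // size_tuple.
split; rewrite ?dim_take // ?(leq_trans k1) //.
by apply: sub_span => v; rewrite -(take_takel _ k1) => /mem_take.
Qed.


Lemma mem_take_frame e z (i : 'I_m.+1) (p : 'I_(d i.+1)) j : (p < j)%N ->
  tnth (flag_frame e z i) p \in <<take j (flag_frame e z i)>>%VS.
Proof.
move=> pj; apply: memv_span; rewrite (tnth_nth 0) -(nth_take 0 pj).
by apply: mem_nth; rewrite size_take size_tuple; case: ifP.
Qed.


Lemma flag_frame_basis e z i : basis_of fullv (flag_frame e z i).
Proof. by rewrite basisEfree flag_frame_free subvf size_tuple leqnn. Qed.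

Lemma coord_take e z (i : 'I_m.+1) (q : 'I_(d i.+1)) j v : (j <= q)%N ->
  v \in <<take j (flag_frame e z i)>>%VS -> coord (flag_frame e z i) q v = 0.
Proof.
move=> jq; have fr := flag_frame_free e z i.
move=> vU; set Y := in_tuple (take j (flag_frame e z i)).
have -> : v = \sum_l coord Y l v *: Y`_l by exact: coord_span.
rewrite linear_sum big1 // => -[l ls] _; rewrite linearZ /=.
have lj : (l < j)%N by move: ls; rewrite size_take; case: (ltnP j) => [_ //|sj lsz]; exact: leq_trans lsz sj.
rewrite nth_take //.
have ld : (l < d i.+1)%N by rewrite (leq_trans lj) // ltnW // (leq_ltn_trans jq).
by rewrite (coord_free (Ordinal ld)) // -val_eqE /= ltn_eqF ?mulr0 // (leq_trans lj).
Qed.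

Lemma frame_inj e z z' (i : 'I_m.+1) j (p : 'I_(d i.+1)) : (p < j)%N ->
  (forall q, (q < j)%N -> (block V k t i.+1 q <= block V k t i.+1 p)%N) ->
  <<take j (flag_frame e z i)>>%VS = <<take j (flag_frame e z' i)>>%VS ->
  tnth (flag_frame e z' i) p = tnth (flag_frame e z i) p.
Proof.
move=> pj blk eqU; set v := tnth (flag_frame e z' i) p.
set X := flag_frame e z i.
have vU : v \in <<take j X>>%VS by rewrite eqU mem_take_frame.
have vE : v = \sum_(l < d i.+1) coord X l v *: X`_l.
  by apply: coord_basis (memvf v); exact: flag_frame_basis.
have H (q : 'I_(d i.+1)) : coord X q v = (p == q)%:R.
  have [qj|jq] := ltnP q j; last first.
    rewrite (coord_take jq vU); case: eqVneq => // pq.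
    by move: pj; rewrite pq ltnNge jq.
  have [n] := ubnP (q : nat); elim: n q qj => // n IH q qj /ltnSE qn.
  have := congr1 (coord (sval e i) q) vE.
  rewrite coord_frame entry_eq0 ?blk // addr0 => ->.
  rewrite linear_sum /= (bigD1 q) //= linearZ /= -(tnth_nth 0) coord_frame eqxx.
  rewrite (entry_eq0 _ (leqnn _)) addr0 mulr1 big1 ?addr0 // => l lq.
  rewrite linearZ /= -(tnth_nth 0) coord_frame (_ : (l == q) = false); last exact: negbTE.
  rewrite add0r; have [h|h] := leqP (block V k t i.+1 q) (block V k t i.+1 l).
    by rewrite entry_eq0 ?mulr0.
  have lq' : (l < q)%N by rewrite ltnNge; apply: contraTN h => h; rewrite -leqNgt block_le.
  rewrite IH ?(leq_trans lq') // 1?ltnW // ?(ltn_trans lq') //.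
  case: eqVneq => [pl|]; rewrite ?mul0r //.
  by move: h; rewrite -pl ltnNge blk.
rewrite vE (bigD1 p) //= H eqxx scale1r -(tnth_nth 0) big1 ?addr0 // => l lp.
by rewrite H eq_sym (_ : (l == p) = false) ?scale0r //; exact: negbTE.
Qed.

Lemma flag_chart_inj e : injective (@flag_chart K m V k t e).
Proof.
move=> z z' zz'; apply/rowP => c; rewrite -(enum_valK c).
set x := enum_val c; rewrite -!entryE; case: x => -[i [p q]] /= pq.
have U1 : <<take (k i.+1) (flag_frame e z i)>>%VS = <<take (k i.+1) (flag_frame e z' i)>>%VS.
  exact: (congr1 (fun u : flags m V => (u i).1) zz').
have U2 : <<take (rank2 i.+1) (flag_frame e z i)>>%VS = <<take (rank2 i.+1) (flag_frame e z' i)>>%VS.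
  exact: (congr1 (fun u : flags m V => (u i).2) zz').
have : tnth (flag_frame e z' i) p = tnth (flag_frame e z i) p.
  have [pk|kp] := ltnP p (k i.+1).
    apply: frame_inj pk _ U1 => l lk.
    have /andP[kr _] := dims i.
    by rewrite /block [(k _ <= l)%N]leqNgt lk [(rank2 _ <= l)%N]leqNgt (leq_trans lk kr).
  have [pr|rp] := ltnP p (rank2 i.+1).
    apply: frame_inj pr _ U2 => l lr.
    by rewrite /block kp [(rank2 _ <= l)%N]leqNgt lr addn0 (leq_trans (leq_b1 _)) ?leq_addr.
  move: pq; rewrite /block kp rp ltnNge.
  by case: (_ <= q)%N; case: (_ <= q)%N.
move/(congr1 (coord (sval e i) q)); rewrite !coord_frame.
by move/addrI ->.
Qed.

Lemma flag_chart_cover u : is_flag k t u -> exists e, @flag_chart K m V k t e 0 = u.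
Proof.
move=> uF.
have fr0 e i : flag_frame e (0 : 'rV[K]_(fdim m V k t)) i = sval e i.
  apply: eq_from_tnth => p; rewrite tnth_flag_frame big1 ?addr0 // => q _.
  by rewrite /entry; case: insub => [c|]; rewrite ?mxE scale0r.
have E (i : 'I_m.+1) : exists e : (d i.+1).-tuple (V i.+1), basis_of fullv e /\
   <<take (k i.+1) e>>%VS = (u i).1 /\ <<take (rank2 i.+1) e>>%VS = (u i).2.
  have [U12 d1 d2] := uF i.
  set A := vbasis (u i).1; set B := vbasis ((u i).2 :\: (u i).1).
  set C := vbasis ((u i).2)^C.
  have sA : size A = k i.+1 by rewrite size_tuple.
  have sAB : size (A ++ B) = rank2 i.+1.
    rewrite size_cat !size_tuple -d2 -(dimv_cap_compl (u i).2 (u i).1).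
    by rewrite (capv_idPr U12).
  have spAB : <<A ++ B>>%VS = (u i).2.
    rewrite span_cat !(span_basis (vbasisP _)) addvC.
    by rewrite -[RHS](addv_diff_cap (u i).2 (u i).1) (capv_idPr U12).
  have sABC : size ((A ++ B) ++ C) == d i.+1.
    by rewrite size_cat sAB size_tuple -d2 dimv_compl subnKC // dimvS ?subvf.
  exists (Tuple sABC) => /=; split.
    rewrite basisEdim (eqP sABC) leqnn andbT.
    by rewrite span_cat spAB (span_basis (vbasisP _)) addv_complf subvv.
  rewrite -catA take_size_cat // (span_basis (vbasisP _)) catA take_size_cat //.
pose e0 i := sval (cid (E i)); have e0P i := svalP (cid (E i)).
have eP i : basis_of fullv (e0 i) := (e0P i).1.
have [e eE] : exists e : bases m V, forall i, sval e i = e0 i.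
  by unshelve eexists; [exists e0; exact: eP|].
exists e; apply: functional_extensionality_dep => i.
by rewrite /flag_chart fr0 eE; case: (e0P i) => _ [/= -> ->]; case: (u i).
Qed.

End FlagAtlas.

(* Main.v *)
Require Import Defs.

(** Over a chart [a], write the adapted frame at a point as a block unipotent
    matrix [1 + Z] in the basis [a].  Two charts are compared by
    [(1 + Z) B = A (1 + W)], with [B] a constant base change and [A] block lower
    triangular: its diagonal blocks are the transition matrices of the graded
    pieces of the tautological flag.  Up to right multiplication by unipotent
    matrices, the derivative of the transition map [Z |-> W] is
    [Y |-> (A^-1 Y A)^+], the strictly upper part; hence, with [Q_i] and [S_i]
    the determinants of [V_i / U_{i,1}] and [U_{i,2}] and [rho_i] the rank of
    [U_{i,2}],
      [K_F = \prod_i S_i^(d_i - k_i) / Q_i^rho_i],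
      [det W = \prod_i S_i^(d_{i-1} - k_{i-1}) / Q_i^rho_{i+1}],
    where [rho_n = d_n] and [S_1] is trivial.  If the exponents agree, then so do
    the line bundles.  Conversely an isomorphism is given by nowhere vanishing
    polynomials, which are constants.  Exchanging two basis vectors in adjacent
    blocks and moving along the line [e_p + s e_q] multiplies exactly one of the
    [Q_i], [S_i] by a power of [s], so that the exponents must agree. *)

From HB Require Import structures.
From mathcomp Require Import all_boot all_order all_algebra.
From mathcomp Require Import perm complex mxtens.
From mathcomp Require Import all_classical all_reals all_analysis.
From mathcomp Require Import ring zify.
From mathcomp Require mpoly.
Import numFieldNormedType.Exports.
Import Order.TTheory GRing.Theory Num.Theory.

Set Implicit Arguments.
Unset Strict Implicit.
Unset Printing Implicit Defensive.

Local Open Scope classical_set_scope.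
Local Open Scope ring_scope.

(** * Determinants over finite index types *)

Section FiniteDet.
Context (K : comNzRingType).

Definition idet (T : Type) (M : T -> T -> K) n (x : 'I_n -> T) : K :=
  \det (\matrix_(i, j) M (x i) (x j)).

(** Rows and columns undergo the same permutation, so its sign enters twice and cancels. *)
Lemma idet_perm (T : Type) (M : T -> T -> K) n (x : 'I_n -> T) (s : 'S_n) :
  idet M (x \o s) = idet M x.
Proof.
rewrite /idet.
have -> : (\matrix_(i, j) M ((x \o s) i) ((x \o s) j)) =
    row_perm s (col_perm s (\matrix_(i, j) M (x i) (x j))).
  by apply/matrixP => i j; rewrite !mxE.
rewrite row_permE col_permE !det_mulmx !det_perm odd_permV mulrC -mulrA.
by rewrite -signr_addb addbb mulr1.
Qed.

(** Two injective enumerations of one set differ by a permutation, once their lengths have been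
    identified. *)
Lemma idet_eq_codom (T : finType) (M : T -> T -> K) m n
    (x : 'I_m -> T) (y : 'I_n -> T) :
  injective x -> injective y -> (codom x =i codom y) ->
  idet M x = idet M y.
Proof.
move=> xI yI xy.
have xin i : x i \in codom y by rewrite -xy codom_f.
pose s i := iinv (xin i).
have sE i : y (s i) = x i by exact: f_iinv.
have sI : injective s by move=> i j /(congr1 y); rewrite !sE => /xI.
have mn : m = n.
  rewrite -[m]card_ord -[n]card_ord -(card_codom xI) -(card_codom yI).
  exact: eq_card.
subst n; rewrite -(idet_perm M y (perm sI)).
by congr (\det _); apply/matrixP => i j; rewrite !mxE /= !permE !sE.
Qed.

(** A principal minor on a subset of an arbitrary finite type. Any enumeration of the subset
    computes it, so dependent index types and block decompositions need no casts between
    ordinals. *)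
Definition detOn (T : finType) (P : pred T) (M : T -> T -> K) : K :=
  idet M (fun i : 'I_#|P| => enum_val i).

Lemma detOnE (T : finType) (P : pred T) (M : T -> T -> K) n (x : 'I_n -> T) :
  injective x -> (forall t, (t \in codom x) = P t) -> detOn P M = idet M x.
Proof.
move=> xI xP; apply: idet_eq_codom => //; first exact: enum_val_inj.
move=> t; rewrite xP; apply/codomP/idP => [[i ->]|Pt]; first exact: (enum_valP i).
by exists (enum_rank_in Pt t); rewrite enum_rankK_in.
Qed.

Lemma eq_detOn (T : finType) (P P' : pred T) (M M' : T -> T -> K) :
  P =1 P' -> (forall x y, P x -> P y -> M x y = M' x y) ->
  detOn P M = detOn P' M'.
Proof.
move=> PP MM; transitivity (detOn P M').
  congr (\det _); apply/matrixP => i j; rewrite !mxE; apply: MM; exact: (enum_valP _).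
apply: detOnE => [|t]; first exact: enum_val_inj.
rewrite PP; apply/codomP/idP => [[i ->]|Pt]; first exact: (enum_valP i).
by exists (enum_rank_in Pt t); rewrite enum_rankK_in.
Qed.

Lemma detOn_tr (T : finType) (P : pred T) (M : T -> T -> K) :
  detOn P (fun x y => M y x) = detOn P M.
Proof.
by rewrite /detOn /idet -det_tr; congr (\det _); apply/matrixP => i j; rewrite !mxE.
Qed.

Lemma det_detOn n (M : 'M[K]_n) : \det M = detOn predT M.
Proof.
rewrite (@detOnE _ _ _ n id) //; last by move=> t; rewrite codom_f.
by congr (\det _); apply/matrixP => i j; rewrite !mxE.
Qed.

Lemma detOn_reindex (T T' : finType) (P : pred T) (P' : pred T') (f : T -> T')
    (M : T' -> T' -> K) :
  {in P &, injective f} -> (forall x, P x -> P' (f x)) ->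
  (forall y, P' y -> exists2 x, P x & f x = y) ->
  detOn P' M = detOn P (fun x y => M (f x) (f y)).
Proof.
move=> fI fP fS; apply: (@detOnE _ _ _ _ (f \o enum_val)) => [i j|t].
  by move/fI => H; apply: enum_val_inj; apply: H; exact: enum_valP.
apply/codomP/idP => [[i ->]|/fS[x Px <-]]; first by apply: fP; exact: (enum_valP i).
by exists (enum_rank_in Px x); rewrite /= enum_rankK_in.
Qed.

(** Listing the indices of [P1] before the others makes the matrix block lower triangular. *)
Lemma detOn_split (T : finType) (P P1 : pred T) (M : T -> T -> K) :
  (forall x y, P x -> P1 x -> P y -> ~~ P1 y -> M x y = 0) ->
  detOn P M = detOn (predI P P1) M * detOn (predI P (predC P1)) M.
Proof.
move=> M0; set A := predI P P1; set B := predI P (predC P1).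
pose x (i : 'I_(#|A| + #|B|)) : T :=
  match fintype.split i with inl j => enum_val j | inr j => enum_val j end.
have xl j : x (lshift _ j) = enum_val j by rewrite /x (unsplitK (inl j)).
have xr j : x (rshift _ j) = enum_val j by rewrite /x (unsplitK (inr j)).
have xA (j : 'I_#|A|) : A (enum_val j) by exact: (enum_valP j).
have xB (j : 'I_#|B|) : B (enum_val j) by exact: (enum_valP j).
rewrite (@detOnE _ _ _ _ x); last first.
- move=> t; apply/codomP/idP => [[i ->]|Pt].
    case: (split_ordP i) => j ->; rewrite ?xl ?xr.
      by have /andP[] := xA j.
    by have /andP[] := xB j.
  have [h|h] := boolP (P1 t).
    have At : t \in A by rewrite unfold_in /= Pt.
    by exists (lshift _ (enum_rank_in At t)); rewrite xl enum_rankK_in.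
  have Bt : t \in B by rewrite unfold_in /= Pt.
  by exists (rshift _ (enum_rank_in Bt t)); rewrite xr enum_rankK_in.
- move=> i j; case: (split_ordP i) => i' ->; case: (split_ordP j) => j' ->;
    rewrite ?xl ?xr.
  + by move/enum_val_inj ->.
  + move=> e; have /andP[_ a] := xA i'; have /andP[_ /negP[]] := xB j'.
    by rewrite -e.
  + move=> e; have /andP[_ a] := xA j'; have /andP[_ /negP[]] := xB i'.
    by rewrite e.
  + by move/enum_val_inj ->.
rewrite /idet -[X in \det X]submxK (_ : ursubmx _ = 0); last first.
  apply/matrixP => i j; rewrite !mxE xl xr.
  by have /andP[? ?] := xA i; have /andP[? ?] := xB j; exact: M0.
rewrite det_lblock /detOn /idet; congr (_ * _); congr (\det _); apply/matrixP => i j;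
  by rewrite !mxE ?xl ?xr.
Qed.

Lemma detOn_pred0 (T : finType) (P : pred T) (M : T -> T -> K) :
  P =1 pred0 -> detOn P M = 1.
Proof.
move=> P0; rewrite (@eq_detOn _ _ pred0 _ M) // /detOn.
by move: (fun i => _) ; rewrite card0 => x; exact: det_mx00.
Qed.

(** Ordered by increasing [h], the matrix is block lower triangular along the level sets of [h]; the
    induction peels off the top level. *)
Lemma detOn_weight (T : finType) (P : pred T) (M : T -> T -> K) (h : T -> nat) n :
  (forall x, P x -> (h x < n)%N) ->
  (forall x y, P x -> P y -> (h x < h y)%N -> M x y = 0) ->
  detOn P M = \prod_(v < n) detOn (fun x => P x && (h x == v)) M.
Proof.
elim: n P => [|n IH] P hn M0.
  by rewrite big_ord0; apply: detOn_pred0 => x; apply/negP => /hn.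
rewrite big_ord_recr /= (@detOn_split _ _ (fun x => (h x < n)%N)); last first.
  by move=> x y Px xn Py yn; apply: M0 => //; rewrite (leq_trans xn) // leqNgt.
congr (_ * _); last first.
  apply: eq_detOn => // x /=; case: (boolP (P x)) => //= Px.
  by have := hn x Px; rewrite ltnS leq_eqVlt; case: ltngtP.
rewrite IH; first last.
- by move=> x y /andP[? _] /andP[? _]; exact: M0.
- by move=> x /andP[].
apply: eq_bigr => v _; apply: eq_detOn => // x /=.
by case: eqP => [->|]; rewrite ?andbF // ltn_ord !andbT.
Qed.

Lemma detOn_diag (T : finType) (P : pred T) (M : T -> T -> K) :
  (forall x y, P x -> P y -> x != y -> M x y = 0) ->
  detOn P M = \prod_(x | P x) M x x.
Proof.
move=> M0; rewrite /detOn /idet (_ : (\matrix_(i, j) _) =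
  diag_mx (\row_(i < #|P|) M (enum_val i) (enum_val i))); last first.
  apply/matrixP => i j; rewrite !mxE; have [->|ij] := eqVneq i j; first by rewrite mulr1n.
  rewrite mulr0n; apply: M0; try exact: (enum_valP _).
  by apply: contra_neq ij => /enum_val_inj.
rewrite det_diag [RHS](eq_bigl [in P]) // [RHS]big_enum_val /=.
by apply: eq_bigr => i _; rewrite mxE.
Qed.

Lemma detOn_unitrig (T : finType) (P : pred T) (M : T -> T -> K) (h : T -> nat) :
  (forall x y, P x -> P y -> (h x <= h y)%N -> M x y = (x == y)%:R) ->
  detOn P M = 1.
Proof.
move=> M1; rewrite (@detOn_weight _ _ _ h (\max_x h x).+1); first last.
- move=> x y Px Py xy; rewrite M1 ?(ltnW xy) //; case: eqP => // e.
  by rewrite e ltnn in xy.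
- by move=> x _; rewrite ltnS; exact: leq_bigmax.
rewrite big1 // => v _; rewrite detOn_diag.
  by rewrite big1 // => x /andP[Px _]; rewrite M1 // eqxx.
by move=> x y /andP[Px /eqP hx] /andP[Py /eqP hy] /negbTE xy; rewrite M1 ?xy // hx hy.
Qed.

(** A block diagonal matrix is block triangular for any numbering of the fibres, here that of
    [enum_rank]. *)
Lemma detOn_fibers (T J : finType) (P : pred T) (M : T -> T -> K) (h : T -> J) :
  (forall x y, P x -> P y -> h x != h y -> M x y = 0) ->
  detOn P M = \prod_j detOn (fun x => P x && (h x == j)) M.
Proof.
move=> M0; rewrite (@detOn_weight _ _ _ (enum_rank \o h) #|J|); first last.
- move=> x y Px Py /= xy; apply: M0 => //; apply: contraTneq xy => ->.
  by rewrite ltnn.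
- by move=> x _ /=.
rewrite [RHS](reindex (fun v : 'I_#|J| => enum_val v)) /=; last first.
  by apply: onW_bij; exact: enum_val_bij.
apply: eq_bigr => v _; apply: eq_detOn => // x /=; congr andb.
by apply/eqP/eqP => [/val_inj <-|->]; rewrite ?enum_rankK ?enum_valK.
Qed.

Lemma det_tens m n (A : 'M[K]_m) (B : 'M[K]_n) :
  \det (A *t B) = \det A ^+ n * \det B ^+ m.
Proof.
(* [A *t B] is the product of [A *t 1] and [1 *t B]; each is block diagonal once index pairs are
   grouped by their second, respectively first, component. *)
rewrite tensmx_decr det_mulmx; congr (_ * _); rewrite [LHS]det_detOn.
  rewrite (@detOn_fibers _ _ _ _ (fun i : 'I_(m * n) => (mxtens_unindex i).2)); last first.
    move=> x y _ _; case: (mxtens_indexP x) => i j; case: (mxtens_indexP y) => k l.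
    by rewrite !mxtens_indexK tensmxE mxE /= => /negbTE ->; rewrite mulr0.
  rewrite (eq_bigr (fun=> \det A)) ?prodr_const ?card_ord // => j _.
  rewrite det_detOn (@detOn_reindex _ _ predT _ (fun i => mxtens_index (i, j))).
  - by apply: eq_detOn => // x y _ _; rewrite tensmxE mxE eqxx mulr1.
  - by move=> x y _ _ /(congr1 (@mxtens_unindex _ _)); rewrite !mxtens_indexK => -[].
  - by move=> x _; rewrite mxtens_indexK /= eqxx.
  - by move=> y; case: (mxtens_indexP y) => i k; rewrite mxtens_indexK => /eqP /= <-; exists i.
rewrite (@detOn_fibers _ _ _ _ (fun i : 'I_(m * n) => (mxtens_unindex i).1)); last first.
  move=> x y _ _; case: (mxtens_indexP x) => i j; case: (mxtens_indexP y) => k l.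
  by rewrite !mxtens_indexK tensmxE mxE /= => /negbTE ->; rewrite mul0r.
rewrite (eq_bigr (fun=> \det B)) ?prodr_const ?card_ord // => j _.
rewrite det_detOn (@detOn_reindex _ _ predT _ (fun i => mxtens_index (j, i))).
- by apply: eq_detOn => // x y _ _; rewrite tensmxE mxE eqxx mul1r.
- by move=> x y _ _ /(congr1 (@mxtens_unindex _ _)); rewrite !mxtens_indexK => -[].
- by move=> x _; rewrite mxtens_indexK /= eqxx.
- by move=> y; case: (mxtens_indexP y) => i k; rewrite mxtens_indexK => /eqP /= <-; exists k.
Qed.

Lemma det_castmx m n (e : m = n) (M : 'M[K]_m) : \det (castmx (e, e) M) = \det M.
Proof. by case: n / e; rewrite castmx_id. Qed.

Lemma det_mxdiag n (p : 'I_n -> nat) (B : forall i, 'M[K]_(p i)) :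
  \det (\mxdiag_i B i) = \prod_i \det (B i).
Proof.
elim: n p B => [|n IH] p B.
  rewrite [RHS]big_ord0; move: (\mxdiag_i B i).
  have -> : (\sum_i p i = 0)%N by rewrite big_ord0.
  exact: det_mx00.
by rewrite mxdiag_recl det_castmx det_ublock IH [RHS]big_ord_recl.
Qed.

End FiniteDet.

(** * Adapted frames in coordinates *)

Section ChangeOfBasis.
Context (K : fieldType) (vT : vectType K) (n : nat).
Implicit Types X Y Z : n.-tuple vT.

(** Vectors are rows of coordinates, so that changes of basis compose from left to right. *)
Definition basis_chg X Y : 'M[K]_n := \matrix_(p, q) coord Y q (tnth X p).

Lemma basis_chg_mul X Y Z : basis_of fullv Y -> basis_chg X Y *m basis_chg Y Z = basis_chg X Z.
Proof.
move=> Yb; apply/matrixP => p q; rewrite !mxE.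
rewrite [in RHS](coord_basis Yb (memvf (tnth X p))) linear_sum /=.
by apply: eq_bigr => l _; rewrite !mxE linearZ /= -tnth_nth.
Qed.

Lemma basis_chg_id X : basis_of fullv X -> basis_chg X X = 1%:M.
Proof.
move=> Xb; apply/matrixP => p q; rewrite !mxE (tnth_nth 0).
by rewrite coord_free ?(basis_free Xb).
Qed.

Lemma basis_chg_unit X Y : basis_of fullv X -> basis_of fullv Y -> basis_chg X Y \in unitmx.
Proof.
by move=> Xb Yb; have := mulmx1_unit (etrans (basis_chg_mul X X Yb) (basis_chg_id Xb)) => -[].
Qed.

Lemma basis_chg_sum X Y p : basis_of fullv Y ->
  tnth X p = \sum_q basis_chg X Y p q *: tnth Y q.
Proof.
move=> Yb; rewrite {1}(coord_basis Yb (memvf (tnth X p))).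
by apply: eq_bigr => q _; rewrite !mxE -tnth_nth.
Qed.

End ChangeOfBasis.

Section Frames.
Context (K : numFieldType) (m : nat) (V : nat -> vectType K) (k t : nat -> nat).
Local Notation d := (vdim V).
Local Notation rank2 := (rank2 V k t).
Local Notation block := (block V k t).
Local Notation fdim := (fdim m V k t).
Local Notation F := (flag_variety m V k t).
Local Notation adapted i := (@adapted K m V k t i).
Context (dims : forall i : 'I_m.+1, (k i.+1 <= rank2 i.+1 <= d i.+1)%N).
Implicit Types (a b e : bases m V) (z w : 'rV[K]_fdim) (i : 'I_m.+1).

Definition strict_upper z i : 'M[K]_(d i.+1) := \matrix_(p, q) entry z p q.

Definition unip z i : 'M[K]_(d i.+1) := 1%:M + strict_upper z i.

(** As changes of frame, these respect the spans of the first [k i.+1] and of the first [rank2 i.+1]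
    vectors. *)
Definition block_lower i (M : 'M[K]_(d i.+1)) :=
  forall p q : 'I_(d i.+1), (block i.+1 p < block i.+1 q)%N -> M p q = 0.

Lemma block_lower_mul i (M N : 'M[K]_(d i.+1)) :
  block_lower M -> block_lower N -> block_lower (M *m N).
Proof.
move=> Ml Nl p q pq; rewrite mxE big1 // => l _.
have [h|h] := ltnP (block i.+1 p) (block i.+1 l); first by rewrite Ml ?mul0r.
by rewrite (Nl l) ?mulr0 // (leq_ltn_trans h).
Qed.

Lemma sval_basis e i : basis_of fullv (sval e i).
Proof. exact: (svalP e). Qed.

Lemma basis_chg_frame e z i : basis_chg (flag_frame e z i) (sval e i) = unip z i.
Proof. by apply/matrixP => p q; rewrite !mxE coord_frame. Qed.

(** The transpose is unitriangular for the grading by [block], and so are its principal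
    submatrices. *)
Lemma unip_det z i (P : pred 'I_(d i.+1)) : detOn P (unip z i) = 1.
Proof.
rewrite -detOn_tr; apply: (@detOn_unitrig _ _ _ _ (fun p : 'I_(d i.+1) => block i.+1 p)).
move=> p q _ _ pq; by rewrite !mxE entry_eq0 // addr0 eq_sym.
Qed.

Lemma unip_unit z i : unip z i \in unitmx.
Proof. by rewrite unitmxE det_detOn unip_det unitr1. Qed.

(** Equal spans kill the coordinates in later blocks. Conversely, triangularity gives inclusions of
    spans, which equal dimensions turn into equalities. *)
Lemma chart_eqP a b z w : flag_chart a z = flag_chart b w <->
  (forall i, block_lower (basis_chg (flag_frame a z i) (flag_frame b w i))).
Proof.
split=> [ab i p q pq|H].
  rewrite mxE.
  have [pk|kp] := ltnP p (k i.+1).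
    have U : <<take (k i.+1) (flag_frame a z i)>>%VS =
        <<take (k i.+1) (flag_frame b w i)>>%VS.
      exact: (congr1 (fun u : flags m V => (u i).1) ab).
    apply: (@coord_take _ _ _ _ _ _ _ _ _ (k i.+1)); last by rewrite -U mem_take_frame.
    have /andP[kr _] := dims i.
    rewrite leqNgt; apply/negP => qk; move: pq.
    by rewrite /block ![(k _ <= _)%N]leqNgt qk ![(rank2 _ <= _)%N]leqNgt (leq_trans qk kr).
  have [pr|rp] := ltnP p (rank2 i.+1).
    have U : <<take (rank2 i.+1) (flag_frame a z i)>>%VS =
        <<take (rank2 i.+1) (flag_frame b w i)>>%VS.
      exact: (congr1 (fun u : flags m V => (u i).2) ab).
    apply: (@coord_take _ _ _ _ _ _ _ _ _ (rank2 i.+1)); last by rewrite -U mem_take_frame.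
    rewrite leqNgt; apply/negP => qr; move: pq.
    by rewrite /block kp ltnNge ![(rank2 _ <= _)%N]leqNgt qr addn0 (leq_trans (leq_b1 _)) ?leq_addr.
  move: pq; rewrite /block kp rp ltnNge.
  by case: (_ <= q)%N; case: (_ <= q)%N.
have sub i j : (j <= d i.+1)%N ->
    (forall p q : 'I_(d i.+1), (p < j)%N -> (j <= q)%N -> (block i.+1 p < block i.+1 q)%N) ->
    (<<take j (flag_frame a z i)>> <= <<take j (flag_frame b w i)>>)%VS.
  move=> jd blk; apply/span_subvP => v /(nthP 0)[p ps <-].
  have pj : (p < j)%N by move: ps; rewrite size_takel // size_tuple.
  rewrite nth_take // -(tnth_nth 0 _ (Ordinal (leq_trans pj jd))).
  rewrite (basis_chg_sum _ _ (flag_frame_basis b w i)); apply: rpred_sum => q _.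
  have [qj|jq] := ltnP q j; first by rewrite rpredZ // mem_take_frame.
  by rewrite H ?scale0r ?rpred0 // blk.
have /(_ _)/= Pa := flag_chart_points dims a z.
have /(_ _)/= Pb := flag_chart_points dims b w.
apply: functional_extensionality_dep => i.
have [_ a1 a2] := Pa i; have [_ b1 b2] := Pb i; have /andP[kr rd] := dims i.
rewrite /flag_chart; congr pair; apply/eqP; rewrite eqEdim.
  rewrite sub ?(leq_trans kr) //=; last first.
    move=> p q pk kq.
    by rewrite /block [(k _ <= p)%N]leqNgt pk [(rank2 _ <= p)%N]leqNgt (leq_trans pk kr) kq.
  move: a1 b1; rewrite /flag_chart /= => -> ->; exact: leqnn.
rewrite sub //=; last first.
  move=> p q pk kq.
  by rewrite /block [(rank2 _ <= p)%N]leqNgt pk kq (leq_trans kr kq) addn0 ltnS leq_b1.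
move: a2 b2; rewrite /flag_chart /= => -> ->; exact: leqnn.
Qed.

Lemma local_coordK a u : @in_chart K F a u -> flag_chart a (@local_coord K F a u) = u.
Proof.
move=> [z _ zu]; apply: (@xgetPex _ 0 [set z | flag_chart a z = u]).
by exists z.
Qed.

Lemma local_coord_chart a z : @local_coord K F a (flag_chart a z) = z.
Proof.
apply: (flag_chart_inj dims (e := a)); apply: local_coordK.
by exists z.
Qed.

Lemma adaptedE i a b u : adapted i a b u =
  basis_chg (adapted_frame k t i a u) (adapted_frame k t i b u) :> 'M[K]_(d i.+1).
Proof. by []. Qed.

Definition base_chg a b i : 'M[K]_(d i.+1) := basis_chg (sval a i) (sval b i).

(** Both sides are the change from the adapted frame of [a] to the fixed basis [b], factored in two
    ways. This is the relation [(1 + Z) B = A (1 + W)]. *)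
Lemma adapted_unip i a b u :
  adapted i a b u *m unip (@local_coord K F b u) i =
  unip (@local_coord K F a u) i *m base_chg a b i.
Proof.
rewrite adaptedE -(basis_chg_frame b (@local_coord K F b u)).
rewrite -(basis_chg_frame a (@local_coord K F a u)).
rewrite !basis_chg_mul //; first exact: sval_basis.
exact: flag_frame_basis.
Qed.

Lemma adapted_unit i a b u : adapted i a b u \in unitmx.
Proof. by rewrite adaptedE basis_chg_unit // flag_frame_basis. Qed.

Lemma adapted_mul i a b c u :
  adapted i a b u *m adapted i b c u = adapted i a c u.
Proof. by rewrite !adaptedE basis_chg_mul // flag_frame_basis. Qed.

Lemma adapted_id i a u : adapted i a a u = 1%:M.
Proof. by rewrite adaptedE basis_chg_id // flag_frame_basis. Qed.

Lemma adapted_lower i a b u : @in_chart K F a u -> @in_chart K F b u ->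
  block_lower (adapted i a b u).
Proof.
move=> ua ub; have /chart_eqP := etrans (local_coordK ua) (esym (local_coordK ub)).
exact.
Qed.

(** Since [1 + W] is invertible, the equation determines its left factor, which must be the change
    between the two frames. Any block lower triangular solution therefore certifies that the flags
    coincide. *)
Lemma chart_eq_of a b z w (A : forall i, 'M[K]_(d i.+1)) :
  (forall i, block_lower (A i)) ->
  (forall i, A i *m unip w i = unip z i *m base_chg a b i) ->
  flag_chart a z = flag_chart b w.
Proof.
move=> Al AE; apply/chart_eqP => i.
suff -> : basis_chg (flag_frame a z i) (flag_frame b w i) = A i by [].
apply: (can_inj (mulmxK (unip_unit w i))).
rewrite AE -(basis_chg_frame b w) -(basis_chg_frame a z) /base_chg.
rewrite !basis_chg_mul //; first exact: sval_basis.
exact: flag_frame_basis.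
Qed.

End Frames.

(** * Derivative of the transition maps *)

Lemma near_forall (T : Type) (F : set_system T) {FF : Filter F} (I : finType)
    (P : I -> T -> Prop) :
  (forall i, \forall x \near F, P i x) -> \forall x \near F, forall i, P i x.
Proof.
move=> FP; have : \forall x \near F, forall i, i \in enum I -> P i x.
  elim: (enum I) => [|j s IH]; first exact: nearW.
  apply: filterS2 (FP j) IH => x Pj Ps i; rewrite inE => /orP[/eqP -> //|].
  exact: Ps.
by apply: filterS => x Px i; apply: Px; rewrite mem_enum.
Qed.

Section Jacobian.
Context (K : numFieldType).

Lemma mx_entry_norm m n (x : 'M[K]_(m, n)) i j : `|x i j| <= `|x|.
Proof.
rewrite [leRHS]/Num.norm /= mx_normE -[leLHS]nngE num_le.
exact: (le_bigmax _ _ (i, j)).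
Qed.

Lemma mx_norm_le m n (x : 'M[K]_(m, n)) c : 0 <= c ->
  (forall i j, `|x i j| <= c) -> `|x| <= c.
Proof.
move=> c0 xc; have [->//|x0] := eqVneq `|x| 0.
by case: (mx_norm_neq0 x0) => ij; rewrite [leLHS]/Num.norm /= => ->.
Qed.

Lemma mulmx_norm m n (h : 'rV[K]_m) (A : 'M[K]_(m, n)) c : 0 <= c ->
  (forall i j, `|A i j| <= c) -> `|h *m A| <= m%:R * c * `|h|.
Proof.
move=> c0 Ac; apply: mx_norm_le => [|i j]; first by rewrite !mulr_ge0.
rewrite mxE (le_trans (ler_norm_sum _ _ _)) //.
rewrite (le_trans (ler_sum _ (G := fun=> c * `|h|) _)) //.
  move=> l _; rewrite normrM mulrC ler_pM //; exact: mx_entry_norm.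
by rewrite sumr_const card_ord -mulrA mulr_natl.
Qed.

Lemma mulmx_continuous m n (A : 'M[K]_(m, n)) :
  continuous (fun h : 'rV[K]_m => h *m A).
Proof.
apply: (bounded_linear_continuous (f := mulmxr A)); apply/linear_boundedP.
near=> r => h.
apply: le_trans (mulmx_norm (c := `|A|) _ _ _) _ => //; first exact: mx_entry_norm.
apply: ler_wpM2r => //; near: r; apply: nbhs_pinfty_ge; rewrite ger0_real //.
Unshelve. all: by end_near. Qed.

(** [S] is only required to be continuous at [0], so that no derivative of a
    matrix inverse has to be computed. *)
Lemma jacobian_secant m n (f : 'rV[K]_m -> 'rV[K]_n)
    (z : 'rV[K]_m)
    (S : 'rV[K]_m -> 'M[K]_(m, n)) :
  (forall i j, {for (0 : 'rV[K]_m), continuous (fun h => S h i j)}) ->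
  (\forall h \near (0 : 'rV[K]_m), f (h + z) = f z + h *m S h) ->
  jacobian f z = S 0.
Proof.
move=> Sc fE.
suff fd : 'd f z = mulmxr (S 0) :> ('rV[K]_m -> 'rV[K]_n).
  by apply/row_matrixP => i; rewrite !rowE /jacobian mul_rV_lin1 fd.
apply: diff_unique; first exact: mulmx_continuous.
apply/eqaddoP => _/posnumP[e] /=.
(* Multiplying a row of length [m] by a matrix costs a factor [m] in the sup norm; dividing by
   [m.+1] absorbs it and keeps the divisor nonzero. *)
pose c := e%:num / m.+1%:R.
have c0 : 0 < c by rewrite divr_gt0.
have Sn : \forall h \near (0 : 'rV[K]_m), forall i j, `|(S h - S 0) i j| <= c.
  apply near_forall; first exact: nbhs_filter.
  move=> i; apply near_forall; first exact: nbhs_filter. move=> j.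
  have /cvgrPdist_le /(_ c c0) := Sc i j.
  by apply: filterS => h; rewrite distrC !mxE.
near=> h.
have -> : (f \o shift z - (cst (f z) + mulmxr (S 0))) h = h *m (S h - S 0).
  rewrite /= mulmxBr [LHS](_ : _ = f (h + z) - (f z + h *m S 0)) //.
  by rewrite (near fE h) // opprD addrACA subrr add0r.
apply: le_trans (mulmx_norm _ (ltW c0) _) _; first by move: (near Sn h); apply.
rewrite /= ler_wpM2r // mulrC /c -mulrA ger_pMr // ler_pdivrMl // mulr1 ler_nat.
exact: leqnSn.
Unshelve. all: by end_near. Qed.

End Jacobian.

(** * Strictly block upper parts and the maps [Y |-> (L Y R)^+] *)

Section StrictUpper.
Context (K : numFieldType) (m : nat) (V : nat -> vectType K) (k t : nat -> nat).
Local Notation d := (vdim V).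
Local Notation block := (block V k t).
Local Notation fdim := (fdim m V k t).
Local Notation position := (position m V).
Local Notation coord_index := (coord_index m V k t).
Local Notation mxs := (forall i : 'I_m.+1, 'M[K]_(d i.+1)).
Implicit Types (y z w : 'rV[K]_fdim) (i : 'I_m.+1) (L M R : mxs).

Definition is_coord (c : position) : bool :=
  (block (tag c).+1 (tagged c).1 < block (tag c).+1 (tagged c).2)%N.

(** This is [M |-> M^+], with the surviving entries listed as chart coordinates. *)
Definition su_row M : 'rV[K]_fdim :=
  \row_c M (tag (val (enum_val c : coord_index)))
    (tagged (val (enum_val c : coord_index))).1
    (tagged (val (enum_val c : coord_index))).2.

Lemma su_row_linear a L M :
  su_row (fun i => a *: L i + M i) = a *: su_row L + su_row M.
Proof. by apply/rowP => c; rewrite !mxE. Qed.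

Lemma strict_upper_row M i (p q : 'I_(d i.+1)) : strict_upper (su_row M) i p q =
  if (block i.+1 p < block i.+1 q)%N then M i p q else 0.
Proof.
rewrite mxE /entry; case: insubP => [c cP cE|/negbTE -> //].
by rewrite mxE enum_rankK cE [X in if X then _ else _]cP.
Qed.

Lemma strict_upperE y i (p q : 'I_(d i.+1)) : (block i.+1 q <= block i.+1 p)%N ->
  strict_upper y i p q = 0.
Proof. by move=> pq; rewrite mxE entry_eq0. Qed.

Lemma strict_upper_eq y y' : (forall i p q, strict_upper y i p q = strict_upper y' i p q) ->
  y = y'.
Proof.
move=> yy; apply/rowP => c; rewrite -(enum_valK c) -!entryE.
set x := val _; by have := yy (tag x) (tagged x).1 (tagged x).2; rewrite !mxE.
Qed.

Lemma strict_upper_linear i : linear (fun y => strict_upper y i).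
Proof.
move=> a y z; apply/matrixP => p q; rewrite !mxE /entry.
by case: insubP => [c _ _|_]; rewrite ?mxE // mulr0 addr0.
Qed.

Definition conj_su L R y := su_row (fun i => L i *m strict_upper y i *m R i).

Lemma conj_su_linear L R : linear (conj_su L R).
Proof.
move=> a y z; rewrite /conj_su -su_row_linear; congr su_row.
apply: functional_extensionality_dep => i.
by rewrite strict_upper_linear mulmxDr mulmxDl -scalemxAr -scalemxAl.
Qed.
HB.instance Definition _ L R := GRing.isLinear.Build K _ _ _
  (conj_su L R) (conj_su_linear L R).

(** Strictly block upper times block unipotent is strictly block upper, so truncation loses
    nothing. *)
Lemma strict_upper_unip M z : 
  (forall i (p q : 'I_(d i.+1)), (block i.+1 q <= block i.+1 p)%N -> M i p q = 0) ->
  forall i, strict_upper (su_row (fun i => M i *m unip z i)) i = M i *m unip z i.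
Proof.
move=> M0 i; apply/matrixP => p q; rewrite strict_upper_row.
case: ltnP => // qp; rewrite mxE big1 // => l _.
have [lp|pl] := leqP (block i.+1 l) (block i.+1 p); first by rewrite M0 ?mul0r.
rewrite 3!mxE entry_eq0 ?(leq_trans qp) ?(ltnW pl) // addr0.
case: eqP => [e|_]; last by rewrite mulr0.
by move: pl; rewrite e ltnNge qp.
Qed.

Definition conj_mx L R : 'M[K]_fdim := lin1_mx (conj_su L R).

Lemma mul_conj_mx L R y : y *m conj_mx L R = conj_su L R y.
Proof. exact: mul_rV_lin1. Qed.

Lemma strict_upper_delta (c : coord_index) i p q :
  strict_upper (delta_mx 0 (enum_rank c)) i p q = (val c == Position p q)%:R.
Proof.
rewrite mxE /entry; case: insubP => [c' _ <-|].
  by rewrite mxE eqxx /= (inj_eq enum_rank_inj) (inj_eq val_inj) eq_sym.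
by apply: contraNeq; rewrite eq_sym pnatr_eq0 eqb0 negbK => /eqP <-; exact: (valP c).
Qed.

(** The entries are values on elementary matrices. The Kronecker symbol compares dependent
    positions, which also covers a [c0] and a [c] at different vertices; the double sum is collapsed
    later, at a common vertex. *)
Lemma det_conj_mx L R : \det (conj_mx L R) =
  detOn is_coord (fun c0 c => \sum_q0 (\sum_p0 L (tag c) (tagged c).1 p0 *
     (c0 == Position p0 q0)%:R) * R (tag c) q0 (tagged c).2).
Proof.
rewrite det_detOn (@detOn_reindex _ _ _ predT _ (fun c : coord_index => enum_rank c)) //.
- rewrite (@detOn_reindex _ _ _ predT is_coord (val : coord_index -> position)).
  + apply: eq_detOn => // c0 c _ _.
    rewrite mxE /conj_su mxE enum_rankK mxE; apply: eq_bigr => q _; congr (_ * _).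
    by rewrite mxE; apply: eq_bigr => p _; congr (_ * _); exact: strict_upper_delta.
  + by move=> x y _ _; exact: val_inj.
  + by move=> x _; exact: (valP x).
  + by move=> y yP; exists (Sub y yP : coord_index); rewrite ?SubK.
- by move=> x y _ _; exact: enum_rank_inj.
- by move=> y _; exists (enum_val y); rewrite ?enum_valK.
Qed.

Lemma Position_inj i (p p' q q' : 'I_(d i.+1)) :
  (Position p q == Position p' q') = (p == p') && (q == q').
Proof. by rewrite /Position eq_Tagged /= -pair_eqE. Qed.

Lemma conj_entry i (A B : 'M[K]_(d i.+1)) (p q p' q' : 'I_(d i.+1)) :
  \sum_q0 (\sum_p0 A p p0 * (Position p' q' == Position p0 q0)%:R) * B q0 q =
  A p p' * B q' q.
Proof.
transitivity (\sum_q0 (\sum_p0 A p p0 * ((p' == p0) && (q' == q0))%:R) * B q0 q).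
  by apply: eq_bigr => q0 _; congr (_ * _); apply: eq_bigr => p0 _; rewrite Position_inj.
rewrite (bigD1 q') //= [X in _ + X]big1 ?addr0; last first.
  by move=> l /negbTE ql; rewrite big1 ?mul0r // => l' _; rewrite [q' == l]eq_sym ql andbF mulr0.
congr (_ * _); rewrite (bigD1 p') //= [X in _ + X]big1 ?addr0 ?eqxx ?mulr1 //.
by move=> l /negbTE pl; rewrite [p' == l]eq_sym pl mulr0.
Qed.

(** Right multiplication acts on each row separately; row [p] has its free entries in the blocks
    after that of [p], where the action is by a submatrix of [R i]. *)
Lemma det_rmul R : \det (conj_mx (fun=> 1%:M) R) =
  \prod_(i < m.+1) \prod_(p < d i.+1)
    detOn (fun q : 'I_(d i.+1) => (block i.+1 p < block i.+1 q)%N) (R i).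
Proof.
rewrite det_conj_mx.
pose J : finType := {i : 'I_m.+1 & 'I_(d i.+1)}.
pose row_of (c : position) : J := Tagged (fun i : 'I_m.+1 => 'I_(d i.+1)) (tagged c).1.
rewrite (@detOn_fibers _ _ J _ _ row_of); last first.
  move=> c0 [j [p' q']] _ _ /= ne; rewrite big1 // => q0 _.
  rewrite big1 ?mul0r // => p0 _; rewrite mxE.
  have [e|] := eqVneq p' p0; last by rewrite mul0r.
  rewrite mul1r; case: eqP => // c0E; move: ne.
  by rewrite c0E /row_of /= -e eqxx.
rewrite [RHS]sig_big_dep /=.
apply: eq_bigr => -[i p] _ /=.
rewrite (@detOn_reindex _ _ _ (fun q : 'I_(d i.+1) => (block i.+1 p < block i.+1 q)%N)
  _ (fun q => Position p q)).
- apply: eq_detOn => [q|q q' _ _]; first by [].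
  by rewrite conj_entry mxE eqxx mul1r.
- by move=> q q' _ _ /eqP; rewrite Position_inj eqxx => /eqP.
- by move=> q pq; rewrite /is_coord /= pq eqxx.
- move=> [j [p' q]] /andP[cP /eqP e]; move: cP; rewrite /is_coord /=.
  have ij : j = i := congr1 tag e; subst j.
  move/eqP: e; rewrite /row_of /= eq_Tagged /= => /eqP <- pq.
  by exists q.
Qed.

(** Left multiplication acts on each column separately, through the transpose of a submatrix of
    [L i]. *)
Lemma det_lmul L : \det (conj_mx L (fun=> 1%:M)) =
  \prod_(i < m.+1) \prod_(q < d i.+1)
    detOn (fun p : 'I_(d i.+1) => (block i.+1 p < block i.+1 q)%N) (L i).
Proof.
rewrite det_conj_mx.
pose J : finType := {i : 'I_m.+1 & 'I_(d i.+1)}.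
pose col_of (c : position) : J := Tagged (fun i : 'I_m.+1 => 'I_(d i.+1)) (tagged c).2.
rewrite (@detOn_fibers _ _ J _ _ col_of); last first.
  move=> c0 [j [p' q']] _ _ /= ne; rewrite big1 // => q0 _.
  rewrite mxE; have [e|] := eqVneq q0 q'; last by rewrite mulr0.
  rewrite mulr1 big1 // => p0 _; case: eqP => [c0E|]; last by rewrite mulr0.
  by move: ne; rewrite c0E /col_of /= -e eqxx.
rewrite [RHS]sig_big_dep /=.
apply: eq_bigr => -[i q] _ /=.
rewrite (@detOn_reindex _ _ _ (fun p : 'I_(d i.+1) => (block i.+1 p < block i.+1 q)%N)
  _ (fun p => Position p q)).
- rewrite -[RHS]detOn_tr; apply: eq_detOn => [p|p p' _ _]; first by [].
  by rewrite conj_entry [X in _ * X]mxE eqxx mulr1.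
- by move=> p p' _ _ /eqP; rewrite Position_inj eqxx andbT => /eqP.
- by move=> p pq; rewrite /is_coord /= pq eqxx.
- move=> [j [p q']] /andP[cP /eqP e]; move: cP; rewrite /is_coord /=.
  have ij : j = i := congr1 tag e; subst j.
  move/eqP: e; rewrite /col_of /= eq_Tagged /= => /eqP <- pq.
  by exists p.
Qed.

End StrictUpper.

(** * Entrywise continuity of matrix-valued maps at a point *)

Section EntrywiseContinuity.
Context (K : numFieldType) (T : topologicalType) (x : T).

Definition mx_cont m n (M : T -> 'M[K]_(m, n)) :=
  forall i j, {for x, continuous (fun y => M y i j)}.

Lemma cont_sum (I : Type) (r : seq I) (P : pred I) (f : I -> T -> K) :
  (forall i, P i -> {for x, continuous (f i)}) ->
  {for x, continuous (fun y => \sum_(i <- r | P i) f i y)}.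
Proof. by move=> fc; apply: cvg_big => //; exact: add_continuous. Qed.

Lemma cont_prod (I : Type) (r : seq I) (P : pred I) (f : I -> T -> K) :
  (forall i, P i -> {for x, continuous (f i)}) ->
  {for x, continuous (fun y => \prod_(i <- r | P i) f i y)}.
Proof. by move=> fc; apply: cvg_big => //; exact: mul_continuous. Qed.

Lemma mx_cont_cst m n (M : 'M[K]_(m, n)) : mx_cont (fun=> M).
Proof. by move=> i j; exact: cvg_cst. Qed.

Lemma mx_cont_add m n (M N : T -> 'M[K]_(m, n)) :
  mx_cont M -> mx_cont N -> mx_cont (fun y => M y + N y).
Proof.
move=> Mc Nc i j; under [X in {for _, continuous X}]eq_fun do rewrite mxE.
exact: (cvgD (Mc i j) (Nc i j)).
Qed.

Lemma mx_cont_mul m n p (M : T -> 'M[K]_(m, n)) (N : T -> 'M[K]_(n, p)) :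
  mx_cont M -> mx_cont N -> mx_cont (fun y => M y *m N y).
Proof.
move=> Mc Nc i j; under [X in {for _, continuous X}]eq_fun do rewrite mxE.
by apply: cont_sum => l _; exact: (cvgM (Mc i l) (Nc l j)).
Qed.

Lemma cont_det n (M : T -> 'M[K]_n) : mx_cont M ->
  {for x, continuous (fun y => \det (M y))}.
Proof.
move=> Mc; apply: cont_sum => s _; apply: cvgM; first exact: cvg_cst.
by apply: cont_prod => i _; exact: Mc.
Qed.

Lemma mx_cont_adj n (M : T -> 'M[K]_n) : mx_cont M -> mx_cont (fun y => \adj (M y)).
Proof.
move=> Mc i j; under [X in {for _, continuous X}]eq_fun do rewrite mxE.
apply: cvgM; first exact: cvg_cst.
apply: cont_det => k l; under [X in {for _, continuous X}]eq_fun do rewrite !mxE.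
exact: Mc.
Qed.

End EntrywiseContinuity.

(** * Block elimination and the Jacobian determinant of a change of chart *)

Section Transition.
Context (K : numFieldType) (m : nat) (V : nat -> vectType K) (k t : nat -> nat).
Local Notation d := (vdim V).
Local Notation rank2 := (rank2 V k t).
Local Notation block := (block V k t).
Local Notation fdim := (fdim m V k t).
Local Notation F := (flag_variety m V k t).
Local Notation adapted i := (@adapted K m V k t i).
Local Notation base_chg a b i := (@base_chg K m V a b i).
Local Notation block_lower := (@block_lower K m V k t _).
Local Notation conj_su := (@conj_su K m V k t).
Local Notation conj_mx := (@conj_mx K m V k t).
Context (dims : forall i : 'I_m.+1, (k i.+1 <= rank2 i.+1 <= d i.+1)%N).
Implicit Types (a b : bases m V) (h y z w : 'rV[K]_fdim) (i : 'I_m.+1).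

(** Padding by the identity keeps the size fixed; the determinant is the leading minor of [1 + G]
    ending with block [j]. *)
Definition leading_mx i (j : nat) (G : 'M[K]_(d i.+1)) : 'M[K]_(d i.+1) :=
  \matrix_(p, q) if (block i.+1 p <= j)%N && (block i.+1 q <= j)%N
                 then (1%:M + G) p q else (p == q)%:R.

(** When the leading minors do not vanish, the inverse of the lower factor [L] of
    the block decomposition [1 + G = L (1 + X)], with [X] strictly block upper:
    row [p] comes from inverting the leading minor of [1 + G] that ends with the
    block of [p]. *)
Definition elim_mx i (G : 'M[K]_(d i.+1)) : 'M[K]_(d i.+1) :=
  \matrix_(p, l) if (block i.+1 l <= block i.+1 p)%N
    then (\det (leading_mx (block i.+1 p) G))^-1 * \adj (leading_mx (block i.+1 p) G) p l
    else 0.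

Lemma elim_mx_lower i (G : 'M[K]_(d i.+1)) : block_lower (elim_mx G).
Proof. by move=> p q pq; rewrite mxE leqNgt pq. Qed.

(** In a column [q] of a block not after that of [p], the leading matrix vanishes at the rows of
    later blocks and agrees with [1 + G] at the others, so cutting off row [p] of its inverse
    changes nothing. *)
Lemma elim_mxE i (G : 'M[K]_(d i.+1)) :
  (forall p : 'I_(d i.+1), \det (leading_mx (block i.+1 p) G) != 0) ->
  forall p q : 'I_(d i.+1), (block i.+1 q <= block i.+1 p)%N ->
    (elim_mx G *m (1%:M + G)) p q = (p == q)%:R.
Proof.
move=> nz p q qp; set j := block i.+1 p.
have : (\det (leading_mx j G))^-1 *: \adj (leading_mx j G) *m leading_mx j G = 1%:M.
  by rewrite -scalemxAl mul_adj_mx -mul_scalar_mx -scalar_mxM mulVf // nz.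
move/matrixP => /(_ p q); rewrite [RHS]mxE => <-; rewrite [LHS]mxE [RHS]mxE.
apply: eq_bigr => l _; rewrite [elim_mx _ _ _]mxE [leading_mx _ _ l q]mxE.
rewrite [X in _ = X * _]mxE -/j qp andbT.
have [lj|jl] := leqP (block i.+1 l) j; first by [].
by case: eqP => [e|_]; rewrite ?mul0r ?mulr0 //; move: jl; rewrite e ltnNge qp.
Qed.

Lemma leading_mx0 i j : leading_mx j (0 : 'M[K]_(d i.+1)) = 1%:M.
Proof. by apply/matrixP => p q; rewrite !mxE addr0; case: ifP. Qed.

Lemma elim_mx0 i : elim_mx (0 : 'M[K]_(d i.+1)) = 1%:M.
Proof.
apply/matrixP => p q; rewrite mxE leading_mx0 det1 invr1 mul1r adj1 !mxE.
by case: leqP => // pq; case: eqP pq => // ->; rewrite ltnn.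
Qed.

Lemma leading_mx_cont (T : topologicalType) (x : T) i j (G : T -> 'M[K]_(d i.+1)) :
  mx_cont x G -> mx_cont x (fun s => leading_mx j (G s)).
Proof.
move=> Gc p q; under [X in {for _, continuous X}]eq_fun do rewrite mxE.
by case: ifP => _; [exact: mx_cont_add (@mx_cont_cst _ _ _ _ _ _) Gc _ _ | exact: cvg_cst].
Qed.

Lemma elim_mx_cont (T : topologicalType) (x : T) i (G : T -> 'M[K]_(d i.+1)) :
  mx_cont x G -> G x = 0 -> mx_cont x (fun s => elim_mx (G s)).
Proof.
move=> Gc perturb_0 p q; under [X in {for _, continuous X}]eq_fun do rewrite mxE.
case: ifP => _; last exact: cvg_cst.
have Lc := @leading_mx_cont _ _ i (block i.+1 p) _ Gc.
apply: cvgM; last exact: (mx_cont_adj Lc).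
by apply: cvgV; [rewrite perturb_0 leading_mx0 det1 oner_neq0 | exact: cont_det Lc].
Qed.

Lemma strict_upper_cont i : mx_cont (0 : 'rV[K]_fdim) (fun h => strict_upper h i).
Proof.
move=> p q; under [X in {for _, continuous X}]eq_fun do rewrite mxE /entry.
case: insubP => [c _ _|_]; last exact: cst_continuous.
exact: coord_continuous.
Qed.

Lemma conj_mx_cont (T : topologicalType) (x : T)
    (L R : T -> forall i, 'M[K]_(d i.+1)) :
  (forall i, mx_cont x (fun s => L s i)) -> (forall i, mx_cont x (fun s => R s i)) ->
  mx_cont x (fun s => conj_mx (L s) (R s)).
Proof.
move=> Lc Rc c0 c; pose v : 'rV[K]_fdim := delta_mx 0 c0.
have -> : (fun s => conj_mx (L s) (R s) c0 c) = (fun s => conj_su (L s) (R s) v 0 c).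
  by apply/funext => s; rewrite mxE.
under [X in {for _, continuous X}]eq_fun do rewrite mxE.
apply: mx_cont_mul (Rc _) _ _; apply: mx_cont_mul (Lc _) _.
exact: mx_cont_cst.
Qed.

Lemma det_eq_of_conj n (P S L R Q : 'M[K]_n) : P *m S = L *m R *m Q ->
  \det P = 1 -> \det Q = 1 -> \det S = \det L * \det R.
Proof.
by move=> /(congr1 determinant) e P1 Q1; move: e; rewrite !det_mulmx P1 Q1 mul1r mulr1.
Qed.

Lemma eq_mulmx_row n1 n2 (M N : 'M[K]_(n1, n2)) :
  (forall y : 'rV[K]_n1, y *m M = y *m N) -> M = N.
Proof. by move=> MN; apply/row_matrixP => i; rewrite !rowE MN. Qed.

Section Point.
Context (a b : bases m V) (u : flags m V).
Hypothesis (ua : @in_chart K F a u) (ub : @in_chart K F b u).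
Let z := @local_coord K F a u.
Let w := @local_coord K F b u.
Let A i := adapted i a b u.
Let A' i := adapted i b a u.
Let E i := base_chg a b i *m invmx (unip w i).
(** With [Y] the displacement of coordinates [h], the identity [A^-1 (1 + Z) E = 1] becomes
    [A^-1 (1 + Z + Y) E = 1 + G h]. *)
Let G h i := A' i *m strict_upper h i *m E i.
Let N h i := elim_mx (G h i).

(** Elimination gives [N (1 + G) = 1 + (N G)^+], hence [1 + W' = (1 + (N G)^+) (1 + W)] for the new
    coordinates. The secant sends [h] to the increment [(N G)^+ (1 + W)]. *)
Definition transition_secant h : 'M[K]_fdim :=
  conj_mx (fun i => N h i *m A' i) E *m conj_mx (fun=> 1%:M) (unip w).

Lemma strict_upper0 i : strict_upper (0 : 'rV[K]_fdim) i = 0.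
Proof.
have := strict_upper_linear i (-1) (0 : 'rV[K]_fdim) 0.
by rewrite scaler0 addr0 scaleN1r addNr.
Qed.

Lemma perturb_0 i : G 0 i = 0.
Proof. by rewrite /G strict_upper0 mulmx0 mul0mx. Qed.

Lemma perturb_cont i : mx_cont (0 : 'rV[K]_fdim) (fun h => G h i).
Proof.
apply: mx_cont_mul (@mx_cont_cst _ _ _ _ _ _).
by apply: mx_cont_mul (@mx_cont_cst _ _ _ _ _ _) _; exact: strict_upper_cont.
Qed.

Lemma secant_cont : mx_cont (0 : 'rV[K]_fdim) transition_secant.
Proof.
apply: mx_cont_mul (@mx_cont_cst _ _ _ _ _ _).
apply: (@conj_mx_cont _ _ (fun h i => N h i *m A' i) (fun=> E)) => i.
  apply: mx_cont_mul (@mx_cont_cst _ _ _ _ _ _).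
  by apply: elim_mx_cont; [exact: perturb_cont | exact: perturb_0].
exact: mx_cont_cst.
Qed.

Lemma adapted_invl i : A' i *m A i = 1%:M.
Proof. by rewrite /A' /A adapted_mul adapted_id. Qed.

Lemma shift_mx_unip i : E i *m unip w i = base_chg a b i.
Proof. by rewrite mulmxKV ?unip_unit. Qed.

(** The matrix [N A^-1] is block lower triangular and [N A^-1 (1 + Z + Y) B = 1 + W'], so the two
    charts give the same flag. *)
Lemma transition_near h :
  (forall i (p : 'I_(d i.+1)), \det (leading_mx (block i.+1 p) (G h i)) != 0) ->
  @local_coord K F b (flag_chart a (h + z)) = w + h *m transition_secant h.
Proof.
move=> nz; rewrite /transition_secant mulmxA !mul_conj_mx.
set x := conj_su (fun i => N h i *m A' i) E h.
set w' := w + _.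
suff -> : flag_chart a (h + z) = flag_chart b w' by rewrite local_coord_chart.
(* On and below the block diagonal this is the elimination identity; above it [N] has zero entries,
   so only [N G] contributes. *)
have elimE i : 1%:M + strict_upper x i = N h i *m (1%:M + G h i).
  apply/matrixP => p q; have [qp|pq] := leqP (block i.+1 q) (block i.+1 p).
    by rewrite elim_mxE // mxE strict_upperE // mxE addr0.
  rewrite mxE strict_upper_row pq mulmxDr mulmx1 [RHS]mxE elim_mx_lower //.
  rewrite mxE add0r; case: eqP pq => [->|_ _]; first by rewrite ltnn.
  by rewrite add0r /G !mulmxA.
have unipE i : unip w' i = (1%:M + strict_upper x i) *m unip w i.
  rewrite /w' /unip [strict_upper (w + _) i](_ : _ =
      strict_upper w i + strict_upper x i *m unip w i).
    by rewrite addrA mulmxDl mul1mx.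
  have := strict_upper_linear i 1 w (conj_su (fun=> 1%:M) (unip w) x).
  rewrite !scale1r => ->; congr (_ + _).
  rewrite /conj_su (@strict_upper_unip _ _ _ _ _ (fun i => 1%:M *m strict_upper x i)) ?mul1mx //.
  by move=> j p q qp; rewrite mul1mx strict_upperE.
apply/esym/(chart_eq_of dims (A := fun i => N h i *m A' i)) => // i.
  apply: block_lower_mul; first exact: elim_mx_lower.
  exact: adapted_lower.
have BB : base_chg a b i *m base_chg b a i = 1%:M.
  by rewrite basis_chg_mul ?basis_chg_id //; exact: sval_basis.
rewrite unipE elimE -[LHS]mulmx1 -[in LHS]BB !mulmxA; congr (_ *m _).
have -> : unip (h + z) i = unip z i + strict_upper h i.
  have := strict_upper_linear i 1 h z; rewrite !scale1r /unip => ->.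
  by rewrite -addrA [strict_upper h i + _]addrC addrA.
rewrite -!mulmxA; congr (_ *m _).
rewrite [in LHS]mulmxDl [LHS]mulmxDr [in RHS]mulmxDl [in RHS]mul1mx; congr (_ + _).
  by rewrite -adapted_unip // mulmxA adapted_invl mul1mx.
by rewrite /G -[RHS]mulmxA shift_mx_unip mulmxA.
Qed.

Lemma jacobian_transition :
  jacobian (fun y => @local_coord K F b (flag_chart a y)) z = transition_secant 0.
Proof.
apply: jacobian_secant; first exact: secant_cont.
(* At [h = 0] all leading minors equal 1; by continuity these finitely many minors stay nonzero
   nearby. *)
have : \forall h \near (0 : 'rV[K]_fdim), forall i (p : 'I_(d i.+1)),
    \det (leading_mx (block i.+1 p) (G h i)) != 0.
  apply near_forall; first exact: nbhs_filter.
  move=> i; apply near_forall; first exact: nbhs_filter. move=> p.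
  pose f (h : 'rV[K]_fdim) := \det (leading_mx (block i.+1 p) (G h i)).
  have fc : {for (0 : 'rV[K]_fdim), continuous f}.
    exact: cont_det (@leading_mx_cont _ _ i (block i.+1 p) _ (@perturb_cont i)).
  have f0 : f 0 != 0 by rewrite /f perturb_0 leading_mx0 det1 oner_neq0.
  exact: (cvgr_neq0 _ fc f0).
apply: filterS => h nz; rewrite transition_near //; congr (_ + _).
by rewrite local_coordK.
Qed.

(** At [h = 0] the secant is [Y |-> (A^-1 Y E)^+ (1 + W)] with [(1 + Z) E = A];
    composed with [Y |-> Y (1 + Z)] it becomes [Y |-> (A^-1 Y A)^+ (1 + W)]. *)
Lemma det_jacobian_transition :
  \det (jacobian (fun y => @local_coord K F b (flag_chart a y)) z) =
  \prod_(i < m.+1)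
    ((\prod_(p < d i.+1) detOn (fun q : 'I_(d i.+1) => (block i.+1 p < block i.+1 q)%N) (A i)) *
     (\prod_(q < d i.+1) detOn (fun p : 'I_(d i.+1) => (block i.+1 p < block i.+1 q)%N) (A' i))).
Proof.
have unip1 (y : 'rV[K]_fdim) : \det (conj_mx (fun=> 1%:M) (unip y)) = 1.
  by rewrite det_rmul big1 // => i _; rewrite big1 // => p _; rewrite unip_det.
rewrite big_split /= mulrC -det_rmul -det_lmul jacobian_transition.
apply: (det_eq_of_conj _ (unip1 z) (unip1 w)); apply: eq_mulmx_row => y.
rewrite /transition_secant !mulmxA !mul_conj_mx.
congr conj_su.
apply: strict_upper_eq => i p q; rewrite !strict_upper_row; case: ltnP => // pq.
rewrite /N perturb_0 elim_mx0 !mul1mx.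
rewrite (_ : strict_upper (conj_su _ (unip z) y) i = strict_upper y i *m unip z i); last first.
  rewrite /conj_su (@strict_upper_unip _ _ _ _ _ (fun i => 1%:M *m strict_upper y i)) ?mul1mx //.
  by move=> j p' q' qp; rewrite mul1mx strict_upperE.
have zE : unip z i *m E i = A i.
  by rewrite /E mulmxA -adapted_unip // mulmxK ?unip_unit.
rewrite -2!mulmxA zE mulmxA mxE [RHS]mxE; apply: eq_bigr => l _.
(* The entries dropped from [A^-1 Y] lie on or below the block diagonal, and the block lower factor
   [A] cannot carry them to a strictly upper position. *)
rewrite strict_upper_row mulmx1.
case: ltnP => // lp; rewrite mul0r (_ : A i l q = 0) ?mulr0 //.
by apply: (adapted_lower dims ua ub); rewrite (leq_ltn_trans lp).
Qed.

End Point.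
End Transition.

(** * Transition functions of [det W] and [K_F] *)

Section DetOnField.
Context (K : fieldType).

Lemma detOn_mul (n : nat) (P : pred 'I_n) (M N : 'M[K]_n) :
  (forall p q, P p -> ~~ P q -> M p q = 0) ->
  detOn P (M *m N) = detOn P M * detOn P N.
Proof.
move=> M0; rewrite /detOn /idet -det_mulmx; congr (\det _).
apply/matrixP => i j; rewrite !mxE (bigID P) /= [X in _ + X]big1 ?addr0.
  rewrite [LHS](eq_bigl [in P]) // [LHS]big_enum_val /=.
  by apply: eq_bigr => l _; rewrite !mxE.
by move=> l Pl; rewrite M0 ?mul0r //; exact: (enum_valP i).
Qed.

Lemma detOn_1 (n : nat) (P : pred 'I_n) : detOn P (1%:M : 'M[K]_n) = 1.
Proof.
rewrite detOn_diag; first by rewrite big1 // => x _; rewrite mxE eqxx.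
by move=> x y _ _ /negbTE xy; rewrite mxE xy.
Qed.

Lemma det_principal_submx n (P : pred 'I_n) (M : 'M[K]_n) :
  \det (mxsub (@enum_val _ P) (@enum_val _ P) M) = detOn P M.
Proof. by congr (\det _); apply/matrixP => i j; rewrite !mxE. Qed.

End DetOnField.

Lemma prod_block (K : comPzRingType) (G : nat -> K) (k r n : nat) : (k <= r <= n)%N ->
  \prod_(p < n) G ((k <= p) + (r <= p))%N = G 0%N ^+ k * G 1%N ^+ (r - k) * G 2%N ^+ (n - r).
Proof.
move=> /andP[kr rn].
rewrite -(big_mkord xpredT (fun p => G ((k <= p) + (r <= p))%N)).
rewrite (big_cat_nat (n := r)) //= (big_cat_nat (n := k) (p := r)) //=.
congr (_ * _ * _).
- rewrite (eq_big_nat _ _ (F2 := fun=> G 0%N)) ?prodr_const_nat ?subn0 // => p /andP[_ pk].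
  by rewrite [(k <= p)%N]leqNgt pk [(r <= p)%N]leqNgt (leq_trans pk kr).
- rewrite (eq_big_nat _ _ (F2 := fun=> G 1%N)) ?prodr_const_nat // => p /andP[kp pr].
  by rewrite kp [(r <= p)%N]leqNgt pr.
- rewrite (eq_big_nat _ _ (F2 := fun=> G 2%N)) ?prodr_const_nat // => p /andP[rp pn].
  by rewrite rp (leq_trans kr rp).
Qed.

(** The powers of [B] cancel, and exponents add up by [k + (r - k) = r] and
    [(r - k) + (n - r) = n - k]. *)
Lemma prod_block_exponents (K : fieldType) (B Q S : K) (k r n : nat) :
  B != 0 -> S != 0 -> (k <= r)%N -> (r <= n)%N ->
  Q ^+ k * (B / S) ^+ (r - k) * ((Q / B) ^+ (r - k) * S^-1 ^+ (n - r)) =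
  Q ^+ r / S ^+ (n - k).
Proof.
move=> B0 S0 kr rn.
have -> : (n - k = (r - k) + (n - r))%N by rewrite addnC addnBA // subnK.
rewrite -[X in _ = Q ^+ X / _](subnKC kr); move: (r - k)%N (n - r)%N => x y.
rewrite !exprMn !exprVn !exprD; field.
by rewrite !expf_neq0.
Qed.

Section BundleDet.
Context (K : numFieldType) (m : nat) (V : nat -> vectType K) (k t : nat -> nat).
Local Notation d := (vdim V).
Local Notation rank2 := (rank2 V k t).
Local Notation block := (block V k t).
Local Notation F := (flag_variety m V k t).
Local Notation adapted i := (@adapted K m V k t i).
Local Notation base_chg a b i := (@base_chg K m V a b i).
Context (dims : forall i : 'I_m.+1, (k i.+1 <= rank2 i.+1 <= d i.+1)%N).
Implicit Types (a b : bases m V) (i : 'I_m.+1).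

Definition detQ i a b (u : flags m V) : K := \det (@quot1 K m V k t i a b u).
Definition detS i a b (u : flags m V) : K := \det (@taut2 K m V k t i a b u).

Lemma detQ_on i a b u : detQ i a b u =
  detOn (fun p : 'I_(d i.+1) => (k i.+1 <= p)%N) (adapted i a b u).
Proof. exact: det_principal_submx. Qed.

Lemma detS_on i a b u : detS i a b u =
  detOn (fun p : 'I_(d i.+1) => (p < rank2 i.+1)%N) (adapted i a b u).
Proof. exact: det_principal_submx. Qed.

Lemma block_k i (p q : 'I_(d i.+1)) : (p < k i.+1)%N -> ~~ (q < k i.+1)%N ->
  (block i.+1 p < block i.+1 q)%N.
Proof.
have /andP[kr _] := dims i; rewrite -leqNgt => pk kq.
by rewrite /block [(k _ <= p)%N]leqNgt pk [(rank2 _ <= p)%N]leqNgt (leq_trans pk kr) kq.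
Qed.

Lemma block_r i (p q : 'I_(d i.+1)) : (p < rank2 i.+1)%N -> ~~ (q < rank2 i.+1)%N ->
  (block i.+1 p < block i.+1 q)%N.
Proof.
have /andP[kr _] := dims i; rewrite -leqNgt => pr rq.
by rewrite /block [(rank2 _ <= p)%N]leqNgt pr addn0 rq (leq_trans kr rq) ltnS leq_b1.
Qed.

Section Point.
Context (a b : bases m V) (u : flags m V).
Hypothesis (ua : @in_chart K F a u) (ub : @in_chart K F b u).

Lemma det_adapted i : \det (adapted i a b u) = \det (base_chg a b i).
Proof.
have : \det (adapted i a b u *m unip (@local_coord K F b u) i) =
    \det (unip (@local_coord K F a u) i *m base_chg a b i) by rewrite adapted_unip.
by rewrite !det_mulmx !(det_detOn (unip _ _)) !unip_det mulr1 mul1r.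
Qed.

Lemma det_adapted_neq0 i : \det (adapted i a b u) != 0.
Proof. by rewrite -unitfE -unitmxE adapted_unit. Qed.

(** This is the exact sequence [0 -> U_1 -> V -> V / U_1 -> 0] on determinants; [det V] has a
    constant transition function. *)
Lemma detQ_compl i : \det (base_chg a b i) =
  detOn (fun p : 'I_(d i.+1) => (p < k i.+1)%N) (adapted i a b u) * detQ i a b u.
Proof.
rewrite -det_adapted det_detOn (@detOn_split _ _ _ (fun p : 'I_(d i.+1) => (p < k i.+1)%N)).
  rewrite detQ_on; congr (_ * _); apply: eq_detOn => // p /=.
  by rewrite -leqNgt.
by move=> p q _ pk _ qk; apply: adapted_lower => //; exact: block_k.
Qed.

Lemma detS_compl i : \det (base_chg a b i) =
  detS i a b u * detOn (fun p : 'I_(d i.+1) => (rank2 i.+1 <= p)%N) (adapted i a b u).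
Proof.
rewrite -det_adapted det_detOn (@detOn_split _ _ _ (fun p : 'I_(d i.+1) => (p < rank2 i.+1)%N)).
  rewrite detS_on; congr (_ * _); apply: eq_detOn => // p /=.
  by rewrite -leqNgt.
by move=> p q _ pk _ qk; apply: adapted_lower => //; exact: block_r.
Qed.

Lemma detQ_neq0 i : detQ i a b u != 0.
Proof.
have := det_adapted_neq0 i; rewrite det_adapted detQ_compl.
by rewrite mulf_eq0 negb_or => /andP[].
Qed.

Lemma detS_neq0 i : detS i a b u != 0.
Proof.
have := det_adapted_neq0 i; rewrite det_adapted detS_compl.
by rewrite mulf_eq0 negb_or => /andP[].
Qed.

Lemma base_chg_neq0 i : \det (base_chg a b i) != 0.
Proof. by rewrite -det_adapted det_adapted_neq0. Qed.

(** On an initial union of blocks, minors of block lower triangular matrices are multiplicative. *)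
Lemma detOn_inv i (P : pred 'I_(d i.+1)) :
  (forall p q, P p -> ~~ P q -> (block i.+1 p < block i.+1 q)%N) ->
  detOn P (adapted i b a u) = (detOn P (adapted i a b u))^-1.
Proof.
move=> Pb; have E : detOn P (adapted i a b u) * detOn P (adapted i b a u) = 1.
  rewrite -detOn_mul ?adapted_mul ?adapted_id ?detOn_1 // => p q Pp Pq.
  by apply: adapted_lower => //; exact: Pb.
have nz : detOn P (adapted i a b u) != 0.
  by apply: contra_eq_neq E => ->; rewrite mul0r eq_sym oner_neq0.
by apply: (mulfI nz); rewrite E divff.
Qed.

(** The row and column minors of the Jacobian formula depend only on the block of their index, so
    the block sizes become exponents. *)
Lemma det_jacobian :
  \det (@tangent_bundle K F a b u) =
  \prod_(i < m.+1) (detQ i a b u ^+ rank2 i.+1 / detS i a b u ^+ (d i.+1 - k i.+1)).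
Proof.
rewrite /tangent_bundle (det_jacobian_transition dims ua ub).
apply: eq_bigr => i _; have /andP[kr rd] := dims i.
pose B := \det (base_chg a b i); pose Q := detQ i a b u; pose S := detS i a b u.
have [B0 Q0 S0] : [/\ B != 0, Q != 0 & S != 0].
  by split; [exact: base_chg_neq0 | exact: detQ_neq0 | exact: detS_neq0].
(* Row minors of [A] over the later blocks: [det (V / U_1) = Q] from block 0 and
   [det (V / U_2) = B / S] from block 1; the default 1 is the empty minor of block 2. *)
pose G1 (j : nat) := nth 1 [:: Q; B / S] j.
(* Column minors of [A^-1] over the earlier blocks: empty for block 0, the inverse [Q / B] of
   [det U_1] for block 1, the inverse of [det U_2] for block 2. *)
pose G2 (j : nat) := nth 1 [:: 1; Q / B; S^-1] j.
rewrite (eq_bigr (fun p : 'I_(d i.+1) => G1 ((k i.+1 <= p) + (rank2 i.+1 <= p))%N)); last first.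
  move=> p _; rewrite /block; have [pk|kp] := ltnP p (k i.+1).
    rewrite [(rank2 _ <= p)%N]leqNgt (leq_trans pk kr) /= /G1 /= /Q detQ_on.
    apply: eq_detOn => // q; have [qk|kq] := ltnP q (k i.+1).
      by rewrite [(rank2 _ <= q)%N]leqNgt (leq_trans qk kr).
    by [].
  have [pr|rp] := ltnP p (rank2 i.+1).
    rewrite /G1 /=; apply: (mulfI S0); rewrite mulrCA divff // mulr1.
    rewrite /B detS_compl; congr (_ * _); apply: eq_detOn => // q.
    have [qr|rq] := ltnP q (rank2 i.+1); first by case: (k _ <= q)%N.
    by rewrite (leq_trans kr rq).
  rewrite /G1 /= detOn_pred0 // => q /=.
  by case: (k _ <= q)%N; case: (rank2 _ <= q)%N.
rewrite (@prod_block _ G1) ?kr //.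
rewrite (eq_bigr (fun p : 'I_(d i.+1) => G2 ((k i.+1 <= p) + (rank2 i.+1 <= p))%N)); last first.
  move=> p _; rewrite /block; have [pk|kp] := ltnP p (k i.+1).
    rewrite [(rank2 _ <= p)%N]leqNgt (leq_trans pk kr) /= /G2 /= detOn_pred0 //.
  have [pr|rp] := ltnP p (rank2 i.+1).
    rewrite /G2 /=; apply: (mulfI B0); rewrite mulrCA divff // mulr1.
    transitivity (B * detOn (fun q : 'I_(d i.+1) => (q < k i.+1)%N) (adapted i b a u)).
      congr (_ * _); apply: eq_detOn => // q; have [qk|kq] := ltnP q (k i.+1).
        by rewrite [(rank2 _ <= q)%N]leqNgt (leq_trans qk kr).
      by case: (rank2 _ <= q)%N.
    rewrite detOn_inv => [|x y]; last exact: block_k.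
    by rewrite /B detQ_compl mulrAC divff ?mul1r //;
      have := B0; rewrite /B detQ_compl mulf_eq0 negb_or => /andP[].
  rewrite /G2 /= /S detS_on -detOn_inv; last by move=> x y; exact: block_r.
  apply: eq_detOn => // q; have [qr|rq] := ltnP q (rank2 i.+1).
    by case: (k _ <= q)%N.
  by rewrite (leq_trans kr rq).
rewrite (@prod_block _ G2) ?kr // /G1 /G2 /= !expr1n mul1r mulr1.
exact: prod_block_exponents.
Qed.

End Point.
End BundleDet.

Lemma card_ord_lt n r : (r <= n)%N -> #|(fun p : 'I_n => (p < r)%N)| = r.
Proof.
move=> rn; rewrite -sum1_card -(big_ord_widen n (fun=> 1%N) rn).
by rewrite sum_nat_const card_ord muln1.
Qed.

Lemma card_ord_ge n r : (r <= n)%N -> #|(fun p : 'I_n => (r <= p)%N)| = (n - r)%N.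
Proof.
move=> rn; rewrite -[n in RHS]card_ord -(cardC (fun p : 'I_n => (p < r)%N)).
rewrite card_ord_lt // addKn; apply: eq_card => p.
by rewrite !unfold_in /= -leqNgt.
Qed.

(** * Comparison of [det W] with [K_F] and sufficiency of equal exponents *)

Section Crepant.
Context (K : numFieldType) (m : nat) (V : nat -> vectType K) (k t : nat -> nat).
Local Notation d := (vdim V).
Local Notation rank2 := (rank2 V k t).
Local Notation F := (flag_variety m V k t).
Local Notation adapted i := (@adapted K m V k t i).
Local Notation base_chg a b i := (@base_chg K m V a b i).
Local Notation detQ := (@detQ K m V k t).
Local Notation detS := (@detS K m V k t).
Context (dims : forall i : 'I_m.+1, (k i.+1 <= rank2 i.+1 <= d i.+1)%N).
Implicit Types (a b : bases m V) (i : 'I_m.+1).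

(** In the index [i] of the vertex [i.+1], these are the rank of [U_{i+2,2}], read
    as [V_n] at the last vertex, and that of [V_i / U_{i,1}], read as [0] at the
    first one. *)
Definition next_rank (i : nat) : nat := if i == m then d m.+2 else rank2 i.+2.
Definition prev_corank (i : nat) : nat := if i == 0%N then 0%N else (d i - k i)%N.

Lemma det_W a b u : det_bundle (@Wbundle K m V k t) a b u =
  \prod_(i < m.+1) (detS i a b u ^+ prev_corank i / detQ i a b u ^+ next_rank i).
Proof.
rewrite /det_bundle /Wbundle /sum_bundle det_ublock /tensor_bundle det_tens.
rewrite /trivial_bundle det1 expr1n mulr1 /dual_bundle det_tr det_inv.
rewrite /bigsum_bundle det_mxdiag.
(* Each arrow pairs [Q] at its source with [S] at its target. Beyond these remain [S] at the first
   vertex, with exponent 0, and [Q] at the last, supplied by the summand with [V_n]. *)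
rewrite big_split /= big_ord_recl [X in _ = _ * X]big_ord_recr /=.
rewrite /prev_corank /next_rank /= eqxx expr0 mul1r.
rewrite [RHS]mulrA [RHS]mulrC exprVn; congr (_ * _).
rewrite -big_split /=; apply: eq_bigr => i _.
have /andP[kr1 rd1] := dims (widen_ord (leqnSn m) i).
have /andP[kr2 rd2] := dims (lift ord0 i).
rewrite det_tens det_tr det_inv.
(* The ranks of [quot1] and [taut2] are cardinalities of predicates, exposed here in order to be
   computed. *)
change ((detQ (widen_ord (leqnSn m) i) a b u)^-1
    ^+ #|(fun p : 'I_(d i.+2) => (p < rank2 i.+2)%N)| *
  detS (lift ord0 i) a b u ^+ #|(fun p : 'I_(d i.+1) => (k i.+1 <= p)%N)| =
  detS (lift ord0 i) a b u ^+ (d i.+1 - k i.+1) /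
  detQ (widen_ord (leqnSn m) i) a b u ^+ (if i == m :> nat then d m.+2 else rank2 i.+2)).
rewrite card_ord_lt // card_ord_ge ?(leq_trans kr1) //.
rewrite mulrC exprVn; congr (_ * _^-1); congr (_ ^+ _).
by rewrite (ltn_eqF (ltn_ord i)).
Qed.

Lemma det_canonical a b u : @in_chart K F a u -> @in_chart K F b u ->
  @canonical_bundle K F a b u =
  \prod_(i < m.+1) (detS i a b u ^+ (d i.+1 - k i.+1) / detQ i a b u ^+ rank2 i.+1).
Proof.
move=> ua ub; rewrite /canonical_bundle /det_bundle /dual_bundle det_tr det_inv.
rewrite (det_jacobian dims ua ub) -prodfV; apply: eq_bigr => i _.
by rewrite invfM invrK mulrC.
Qed.

(** The determinant of the whole of [V_{i+1}] is a coboundary. *)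
Definition ref_det a i : K := \det (basis_chg (sval a i) (vbasis {:V i.+1})).

Lemma ref_det_neq0 a i : ref_det a i != 0.
Proof.
rewrite -unitfE -unitmxE basis_chg_unit //; first exact: sval_basis.
exact: vbasisP.
Qed.

Lemma det_base_chg a b i : \det (base_chg a b i) = ref_det a i / ref_det b i.
Proof.
apply: (mulIf (ref_det_neq0 b i)); rewrite divfK ?ref_det_neq0 // -det_mulmx.
by rewrite basis_chg_mul //; exact: sval_basis.
Qed.

Lemma regular_cst (c : K) : @Defs.regular K F (fun=> c).
Proof. by exists (mpoly.mpolyC _ c) => z; rewrite mpoly.mevalC. Qed.

(** The two line bundles then differ only by a power of [S] at the first vertex, where
    [U_{1,2} = V_1] makes [S] a coboundary; powers of [ref_det] trivialize it. *)
Lemma crepant_of_exponents :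
  (forall i : 'I_m.+1, next_rank i = rank2 i.+1) ->
  (forall i : 'I_m.+1, i != ord0 -> prev_corank i = (d i.+1 - k i.+1)%N) ->
  crepant m V k t.
Proof.
move=> nr pc; pose r := (d 1 - k 1)%N.
exists (fun a _ => ref_det a ord0 ^- r); split.
  move=> a; split; first exact: regular_cst.
  by move=> _; rewrite invr_eq0 expf_neq0 // ref_det_neq0.
move=> a b u uF ua ub; rewrite det_canonical // det_W.
have S0 : detS ord0 a b u = ref_det a ord0 / ref_det b ord0.
  rewrite detS_on -det_base_chg -(det_adapted k t a b u) det_detOn.
  apply: eq_detOn => // p; exact: ltn_ord.
rewrite [in RHS](eq_bigr (fun i : 'I_m.+1 => (if i == ord0 then detS ord0 a b u ^- r else 1) *
    (detS i a b u ^+ (d i.+1 - k i.+1) / detQ i a b u ^+ rank2 i.+1))); last first.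
  move=> i _; rewrite nr; case: eqVneq => [->|i0]; last by rewrite mul1r pc.
  rewrite /prev_corank /= expr0 mulrA mulVf ?mul1r //.
  by rewrite expf_neq0 // (detS_neq0 dims ua ub).
rewrite [in RHS]big_split /= -[in RHS]big_mkcond big_pred1_eq S0 expr_div_n invf_div mulrAC.
congr (_ * _); rewrite mulrAC divff ?mul1r //.
by rewrite expf_neq0 // ref_det_neq0.
Qed.

End Crepant.

(** * Necessity of the equality of exponents *)

Section NonvanishingRegular.
Context (K : closedFieldType) (N : nat).

Lemma meval_line (P : mpoly.mpoly N K) (v w : 'I_N -> K) : exists p : {poly K},
  forall s, p.[s] = mpoly.meval (fun i => v i + s * w i) P.
Proof.
exists (mpoly.mmap polyC (fun i => (v i)%:P + (w i)%:P * 'X) P) => s.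
rewrite /mpoly.meval /mpoly.mmap horner_sum; apply: eq_bigr => e _.
rewrite hornerM hornerC /mpoly.mmap1 horner_prod; congr (_ * _).
by apply: eq_bigr => i _; rewrite horner_exp !hornerE mulrC.
Qed.

(** On the line through [v] and [w] the polynomial is univariate without roots, hence constant over
    an algebraically closed field. *)
Lemma nonvanishing_meval_cst (P : mpoly.mpoly N K) :
  (forall v, mpoly.meval v P != 0) -> forall v w, mpoly.meval v P = mpoly.meval w P.
Proof.
move=> P0 v w; have [p pE] := meval_line P v (fun i => w i - v i).
have -> : mpoly.meval v P = p.[0].
  by rewrite pE; congr (mpoly.meval _ P); apply/funext => i; rewrite mul0r addr0.
have -> : mpoly.meval w P = p.[1].
  by rewrite pE; congr (mpoly.meval _ P); apply/funext => i; rewrite mul1r addrC subrK.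
have [/eqP/size_poly1P[c _ ->]|/closed_rootP[s]] := eqVneq (size p) 1%N.
  by rewrite !hornerC.
by rewrite /root pE (negbTE (P0 _)).
Qed.

End NonvanishingRegular.

Section DeltaMul.
Context (K : nzRingType) (n : nat).
Implicit Types (M : 'M[K]_n) (p q x y : 'I_n).

Lemma mulmx_delta M p q x y : (M *m delta_mx p q) x y = M x p * (y == q)%:R.
Proof.
rewrite mxE (bigD1 p) //= big1 ?addr0; first by rewrite mxE eqxx.
by move=> l /negbTE lp; rewrite mxE lp mulr0.
Qed.

Lemma delta_mulmx M p q x y : (delta_mx p q *m M) x y = (x == p)%:R * M q y.
Proof.
rewrite mxE (bigD1 q) //= big1 ?addr0; first by rewrite mxE eqxx andbT.
by move=> l /negbTE lp; rewrite mxE lp andbF mul0r.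
Qed.

End DeltaMul.

(** * Test lines obtained by exchanging two basis vectors *)

Section SwapTest.
Context (K : numFieldType) (m : nat) (V : nat -> vectType K) (k t : nat -> nat).
Local Notation d := (vdim V).
Local Notation rank2 := (rank2 V k t).
Local Notation block := (block V k t).
Local Notation fdim := (fdim m V k t).
Local Notation F := (flag_variety m V k t).
Local Notation adapted i := (@adapted K m V k t i).
Local Notation base_chg a b i := (@base_chg K m V a b i).
Local Notation block_lower := (@block_lower K m V k t _).
Local Notation detQ := (@detQ K m V k t).
Local Notation detS := (@detS K m V k t).
Local Notation next_rank := (next_rank m V k t).
Local Notation prev_corank := (prev_corank V k).
Context (dims : forall i : 'I_m.+1, (k i.+1 <= rank2 i.+1 <= d i.+1)%N).
Context (i : 'I_m.+1) (p q : 'I_(d i.+1)).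
Hypothesis (pq : (block i.+1 p < block i.+1 q)%N).

Lemma neq_pq : (p == q) = false.
Proof. by apply: contraTF pq => /eqP ->; rewrite ltnn. Qed.

Definition swap_perm : forall j : 'I_m.+1, {perm 'I_(d j.+1)} :=
  dfwith (fun j : 'I_m.+1 => 1%g : {perm 'I_(d j.+1)}) i (tperm p q).

Lemma bases_exist : exists a : bases m V, True.
Proof.
by unshelve eexists; [exists (fun j => vbasis {:V j.+1}) => j; exact: vbasisP|].
Qed.

Lemma swap_exist (a : bases m V) : exists b : bases m V, forall j l,
  tnth (sval b j) l = tnth (sval a j) (swap_perm j l).
Proof.
pose e (j : 'I_m.+1) := [tuple tnth (sval a j) (swap_perm j l) | l < d j.+1].
have eb j : basis_of fullv (e j).
  rewrite (perm_basis _ (Y := sval a j)); first exact: (svalP a).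
  by apply/tuple_permP; exists (swap_perm j).
have [b bE] : exists b : bases m V, forall j, sval b j = e j.
  by unshelve eexists; [exists e; exact: eb|].
by exists b => j l; rewrite bE tnth_mktuple.
Qed.

Definition test_coord : coord_index m V k t := Sub (Position p q) pq.

(** The chart of [a] at [s] and the chart of the swapped bases at [s^-1] meet,
    since [e_p + s e_q] and [e_q + s^-1 e_p] span the same line. *)
Definition test_point (s : K) : 'rV[K]_fdim := s *: delta_mx 0 (enum_rank test_coord).

Lemma strict_upper_test s j : strict_upper (test_point s) j =
  s *: dfwith (fun j : 'I_m.+1 => 0 : 'M[K]_(d j.+1)) i (delta_mx p q) j.
Proof.
have -> : strict_upper (test_point s) j =
    s *: strict_upper (delta_mx 0 (enum_rank test_coord)) j.
  have := strict_upper_linear j s (delta_mx 0 (enum_rank test_coord)) 0.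
  rewrite addr0 => ->; rewrite (_ : strict_upper 0 j = 0) ?addr0 //.
  exact: strict_upper0.
congr (_ *: _); apply/matrixP => x y; rewrite strict_upper_delta SubK.
have [ij|ij] := eqVneq i j.
  subst j; rewrite dfwithin mxE Position_inj; congr (nat_of_bool _)%:R.
  by rewrite ![_ == p]eq_sym ![_ == q]eq_sym.
rewrite dfwithout // mxE; case: eqP => // /(congr1 tag) /= e.
by rewrite e eqxx in ij.
Qed.

(** On the indices [p], [q] this has rows [(s, 0)] and [(1, - s^-1)], and it is the identity
    elsewhere. It is the lower factor solving [X (1 + s^-1 E_pq) = (1 + s E_pq) T], with [T] the
    transposition matrix. *)
Definition swap_mx (s : K) : 'M[K]_(d i.+1) := \matrix_(x, y)
  ((x == y)%:R + (s - 1) * ((x == p) && (y == p))%:R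
   + ((x == q) && (y == p))%:R - (s^-1 + 1) * ((x == q) && (y == q))%:R).

Definition swap_adapted s : forall j : 'I_m.+1, 'M[K]_(d j.+1) :=
  dfwith (fun j : 'I_m.+1 => 1%:M : 'M[K]_(d j.+1)) i (swap_mx s).

Section Swapped.
Context (a b : bases m V).
Hypothesis ab : forall j l, tnth (sval b j) l = tnth (sval a j) (swap_perm j l).

Lemma base_chg_swap j : base_chg a b j = \matrix_(x, y) (swap_perm j x == y)%:R.
Proof.
have ba x : tnth (sval a j) x = tnth (sval b j) (swap_perm j x).
  rewrite ab /swap_perm; case: (eqVneq i j) => [ij|ij].
    by subst j; rewrite !dfwithin tpermK.
  by rewrite !dfwithout // !perm1.
apply/matrixP => x y; rewrite !mxE ba (tnth_nth 0).
by rewrite coord_free //; exact: basis_free (svalP b j).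
Qed.

Lemma swap_adaptedE s : s != 0 -> forall j,
  swap_adapted s j *m unip (test_point s^-1) j =
  unip (test_point s) j *m base_chg a b j.
Proof.
move=> s0 j; rewrite base_chg_swap /unip !strict_upper_test /swap_adapted /swap_perm.
have [ij|ij] := eqVneq i j; last first.
  rewrite !dfwithout // !scaler0 !addr0 !mul1mx.
  by apply/matrixP => x y; rewrite !mxE perm1.
subst j; rewrite !dfwithin mulmxDr mulmx1 mulmxDl mul1mx -scalemxAl -scalemxAr.
apply/matrixP => x y; rewrite mxE [X in _ + X]mxE mulmx_delta.
rewrite [RHS]mxE [X in _ = _ + X]mxE delta_mulmx.
rewrite !mxE !eqxx !andbT /= tpermR neq_pq. rewrite andbF mulr0 subr0.
case: tpermP => [->|->|/eqP/negbTE xp /eqP/negbTE xq]; last first.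
- by rewrite xp xq /= !(mulr0, mul0r, addr0, subr0).
- by rewrite !eqxx [q == p]eq_sym neq_pq [q == y]eq_sym [p == y]eq_sym /=; field.
- by rewrite !eqxx neq_pq [q == y]eq_sym [p == y]eq_sym /=; field.
Qed.

Lemma swap_lower s j : block_lower (swap_adapted s j).
Proof.
move=> x y xy; rewrite /swap_adapted; have [ij|ij] := eqVneq i j; last first.
  by rewrite dfwithout // mxE; case: eqP xy => // ->; rewrite ltnn.
subst j; rewrite dfwithin mxE.
have -> : (x == y) = false by apply: contraTF xy => /eqP ->; rewrite ltnn.
have -> : (x == p) && (y == p) = false.
  by apply: contraTF xy => /andP[/eqP -> /eqP ->]; rewrite ltnn.
have -> : (x == q) && (y == q) = false.
  by apply: contraTF xy => /andP[/eqP -> /eqP ->]; rewrite ltnn.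
have -> : (x == q) && (y == p) = false.
  by apply: contraTF xy => /andP[/eqP -> /eqP ->]; rewrite -leqNgt ltnW.
by rewrite !mulr0 subr0 !addr0.
Qed.

Definition test_flag s : flags m V := flag_chart a (test_point s).

Lemma test_flag_swap s : s != 0 -> test_flag s = flag_chart b (test_point s^-1).
Proof.
move=> s0; apply: (chart_eq_of dims (A := swap_adapted s)) => j.
  exact: swap_lower.
exact: swap_adaptedE.
Qed.

Lemma test_flag_a s : @in_chart K F a (test_flag s).
Proof. by exists (test_point s). Qed.

Lemma test_flag_b s : s != 0 -> @in_chart K F b (test_flag s).
Proof. by move=> s0; exists (test_point s^-1) => //; rewrite test_flag_swap. Qed.

Lemma adapted_test s j : s != 0 -> adapted j a b (test_flag s) = swap_adapted s j.
Proof.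
move=> s0; apply: (can_inj (mulmxK (unip_unit (test_point s^-1) j))).
rewrite swap_adaptedE //.
rewrite -[X in unip X j *m _](local_coord_chart dims a).
rewrite -[X in _ *m unip X j](local_coord_chart dims b) -test_flag_swap //.
exact: adapted_unip.
Qed.

(** Outside row [q], the matrix [swap_mx] is diagonal, with [s] at [p] and 1 elsewhere. *)
Lemma detOn_test s (P : pred 'I_(d i.+1)) : s != 0 -> ~~ P q ->
  detOn P (adapted i a b (test_flag s)) = if P p then s else 1.
Proof.
move=> s0 Pq; rewrite adapted_test // /swap_adapted dfwithin.
have xq x : P x -> (x == q) = false by move=> Px; apply: contraNF Pq => /eqP <-.
have E x y : P x -> swap_mx s x y = (x == y)%:R + (s - 1) * ((x == p) && (y == p))%:R.
  by move=> Px; rewrite mxE xq //= !mulr0 subr0 addr0.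
rewrite detOn_diag => [|x y Px Py /negbTE xy]; last first.
  rewrite E // xy; case: eqP => [xp|_]; last by rewrite mulr0 addr0.
  by rewrite -xp eq_sym xy mulr0 addr0.
rewrite (eq_bigr (fun x => if x == p then s else 1)); last first.
  move=> x Px; rewrite E // eqxx andbb; case: eqP => _; last by rewrite mulr0 addr0.
  by rewrite mulr1 addrC subrK.
rewrite -big_mkcondr; case: ifPn => Pp.
  by rewrite (big_pred1 p) // => x /=; case: eqP => [->|]; rewrite ?Pp ?andbF.
by rewrite big_pred0 // => x; apply: contraNF Pp => /andP[Px /eqP <-].
Qed.

Lemma detQ_test_out s j : s != 0 -> i != j -> detQ j a b (test_flag s) = 1.
Proof. by move=> s0 ij; rewrite detQ_on adapted_test // /swap_adapted dfwithout // detOn_1. Qed.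

Lemma detS_test_out s j : s != 0 -> i != j -> detS j a b (test_flag s) = 1.
Proof. by move=> s0 ij; rewrite detS_on adapted_test // /swap_adapted dfwithout // detOn_1. Qed.

End Swapped.

Section CrepantConstants.
Context (f : bases m V -> 'rV[K]_fdim -> K).
Hypotheses (f0 : forall a z, f a z != 0) (fc : forall a z z', f a z = f a z').
Hypothesis fE : forall a b u, is_flag k t u -> @in_chart K F a u ->
  @in_chart K F b u -> f a (@local_coord K F a u) * @canonical_bundle K F a b u =
    det_bundle (@Wbundle K m V k t) a b u * f b (@local_coord K F b u).

(** All vertices other than that of [i] have identity transition matrices at the test flag, so only
    one factor of each product survives. *)
Lemma crepant_test a b s : s != 0 ->
  (forall j l, tnth (sval b j) l = tnth (sval a j) (swap_perm j l)) ->
  let S := detS i a b (test_flag a s) in let Q := detQ i a b (test_flag a s) in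
  f a 0 * (S ^+ (d i.+1 - k i.+1) / Q ^+ rank2 i.+1) =
  f b 0 * (S ^+ prev_corank i / Q ^+ next_rank i).
Proof.
move=> s0 ab S Q; pose u := test_flag a s.
have ua : @in_chart K F a u by exact: test_flag_a.
have ub : @in_chart K F b u by exact: test_flag_b.
have uF : is_flag k t u by exact: flag_chart_points.
have := fE uF ua ub; rewrite (fc a _ 0) (fc b _ 0) [RHS]mulrC det_W //.
rewrite (det_canonical dims ua ub) (bigD1 i) //= [X in _ * (_ / _ * X)]big1 ?mulr1; last first.
  by move=> j; rewrite eq_sym => ij; rewrite detQ_test_out ?detS_test_out // !expr1n divr1.
rewrite (bigD1 i) //= [X in _ = _ * (_ / _ * X)]big1 ?mulr1 //.
by move=> j; rewrite eq_sym => ij; rewrite detQ_test_out ?detS_test_out // !expr1n divr1.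
Qed.

(** Taking [s = 1] gives [C = C']; then [s = 2] separates the powers in characteristic zero. *)
Lemma power_exponent_eq (C C' : K) x y : C != 0 ->
  (forall s, s != 0 -> C * s ^+ x = C' * s ^+ y) -> x = y.
Proof.
move=> C0 H; have := H 1 (oner_neq0 _); rewrite !expr1n !mulr1 => CC.
have := H 2; rewrite -CC pnatr_eq0 => /(_ isT) /(mulfI C0).
rewrite -!natrX => /eqP; rewrite eqr_nat => /eqP e.
by apply/eqP; rewrite -(@eqn_exp2l 2) // e.
Qed.

(** Across the boundary of blocks 0 and 1, [S] stays equal to [B], while the minor on [U_1] picks up
    [s], so [Q = B / s]. The powers of [s] thus compare the exponents of [Q]. *)
Lemma crepant_rank : (p < k i.+1 <= q)%N -> (q < rank2 i.+1)%N ->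
  next_rank i = rank2 i.+1.
Proof.
move=> /andP[pk kq] qr; have [a _] := bases_exist; have [b ab] := swap_exist a.
pose B := \det (base_chg a b i).
have B0 : B != 0 by exact: (base_chg_neq0 k t a b (test_flag a 1) i).
pose r := (d i.+1 - k i.+1)%N; pose r' := prev_corank i.
pose C := f a 0 * (B ^+ r / B ^+ rank2 i.+1).
pose C' := f b 0 * (B ^+ r' / B ^+ next_rank i).
apply/esym/(@power_exponent_eq C C') => [|s s0].
  by rewrite !mulf_neq0 // ?invr_neq0 ?expf_neq0.
have := crepant_test s0 ab; cbv zeta; set S := detS i a b _; set Q := detQ i a b _.
have ua : @in_chart K F a (test_flag a s) by exact: test_flag_a.
have ub : @in_chart K F b (test_flag a s) by exact: test_flag_b.
have -> : S = B.
  rewrite /B (detS_compl dims ua ub) detOn_test //; last by rewrite -ltnNge.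
  by rewrite [(_ <= p)%N]leqNgt (ltn_trans pk (leq_ltn_trans kq qr)) mulr1.
have -> : Q = B / s.
  rewrite /B (detQ_compl dims ua ub) detOn_test //; last by rewrite -leqNgt.
  by rewrite pk mulrAC divff ?mul1r.
by rewrite /C /C' !expr_div_n !invfM !invrK !mulrA.
Qed.

(** Across the boundary of blocks 1 and 2, [S = s] while [Q] stays equal to [B], so the exponents of
    [S] are compared. *)
Lemma crepant_corank : (k i.+1 <= p < rank2 i.+1)%N -> (rank2 i.+1 <= q)%N ->
  prev_corank i = (d i.+1 - k i.+1)%N.
Proof.
move=> /andP[kp pr] rq; have [a _] := bases_exist; have [b ab] := swap_exist a.
pose B := \det (base_chg a b i).
have B0 : B != 0 by exact: (base_chg_neq0 k t a b (test_flag a 1) i).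
pose C := f a 0 / B ^+ rank2 i.+1; pose C' := f b 0 / B ^+ next_rank i.
apply/esym/(@power_exponent_eq C C') => [|s s0].
  by rewrite mulf_neq0 // invr_neq0 // expf_neq0.
have := crepant_test s0 ab; cbv zeta; set S := detS i a b _; set Q := detQ i a b _.
have ua : @in_chart K F a (test_flag a s) by exact: test_flag_a.
have ub : @in_chart K F b (test_flag a s) by exact: test_flag_b.
have -> : S = s by rewrite /S detS_on detOn_test ?pr // -leqNgt.
have -> : Q = B.
  rewrite /B (detQ_compl dims ua ub) detOn_test //.
    by rewrite [(p < _)%N]ltnNge kp /= mul1r.
  by rewrite -leqNgt (leq_trans kp) // (leq_trans (ltnW pr)).
by rewrite /C /C' -!mulrA ![_ ^+ _ / _]mulrC.
Qed.

End CrepantConstants.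

End SwapTest.

(** Algebraic closedness enters only through [closedK], so that [K] carries just the numerical field
    structure of the charts. *)
Lemma crepant_exponents (K : numFieldType) (closedK : forall N (P : mpoly.mpoly N K),
    (forall v, mpoly.meval v P != 0) -> forall v w, mpoly.meval v P = mpoly.meval w P)
  (m : nat) (V : nat -> vectType K) (k t : nat -> nat)
  (dims : forall i : 'I_m.+1, (k i.+1 <= rank2 V k t i.+1 <= vdim V i.+1)%N) :
  crepant m V k t -> forall i : 'I_m.+1, (0 < k i.+1 < rank2 V k t i.+1)%N ->
    next_rank m V k t i = rank2 V k t i.+1 /\
    ((rank2 V k t i.+1 < vdim V i.+1)%N -> prev_corank V k i = (vdim V i.+1 - k i.+1)%N).
Proof.
move=> [f [freg fE]] i /andP[k0 kr]; have /andP[_ rd] := dims i.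
have f0 a z : f a z != 0 by have [_] := freg a; apply.
have fc a z z' : f a z = f a z'.
  have [[P PE] nz] := freg a; rewrite !PE; apply: closedK => v.
  have := nz (\row_j v j); rewrite PE (_ : fun_of_matrix (\row_j v j) 0 = v) //.
  by apply/funext => j; rewrite mxE.
have kd : (k i.+1 < vdim V i.+1)%N by exact: leq_trans kr rd.
(* [p0], [p1] and later [p2] are the first positions of the three blocks. *)
pose p0 := Ordinal (leq_ltn_trans (leq0n _) kd); pose p1 := Ordinal kd.
have b0 : block V k t i.+1 p0 = 0%N.
  by rewrite /block /= ![(_ <= 0)%N]leqNgt k0 (ltn_trans k0 kr).
have b1 : block V k t i.+1 p1 = 1%N by rewrite /block /= leqnn [(rank2 _ _ _ _ <= _)%N]leqNgt kr.
split=> [|rd'].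
  apply: (@crepant_rank _ _ _ _ _ dims i p0 p1 _ f) => //=; first by rewrite b0 b1.
  by rewrite k0 leqnn.
pose p2 := Ordinal rd'.
have b2 : block V k t i.+1 p2 = 2%N by rewrite /block /= leqnn (ltnW kr).
apply: (@crepant_corank _ _ _ _ _ dims i p1 p2 _ f) => //=; first by rewrite b1 b2.
by rewrite leqnn kr.
Qed.

(** * Dimension bounds from a point of the orbit *)

Section OrbitDimensions.
Context (K : numFieldType) (m : nat) (V : nat -> vectType K) (k t : nat -> nat).
Local Notation d := (vdim V).
Context (phi : rep V) (phiO : orbit_kt m.+2 k t phi).

Lemma orbit_k i : (1 <= i <= m.+1)%N -> (k i <= d i)%N.
Proof.
move=> im; have [kE _] := phiO; rewrite -(kE i) ?subn1 //.
by apply: dimvS; exact: subvf.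
Qed.

(** The intersection lies in the kernel and in the image, and the sum of these two lies in
    [V i.+1]. *)
Lemma orbit_t i : (1 <= i <= m)%N ->
  [/\ (t i.+1 <= k i.+1)%N, (t i.+1 <= d i - k i)%N
    & (d i - k i + k i.+1 <= d i.+1 + t i.+1)%N].
Proof.
move=> im; have [kE tE] := phiO.
have kerE := kE i; rewrite subn1 /= in kerE.
have kerE' := kE i.+1; rewrite subn1 /= in kerE'.
have capE := tE i; rewrite (_ : m.+2 - 2 = m)%N in capE; last by rewrite subn2.
have rkE : \dim (limg (phi i)) = (d i - k i)%N.
  rewrite -kerE; last by lia.
  rewrite /vdim -(limg_ker_dim (phi i) fullv) capfv addKn.
  by [].
rewrite -capE // -kerE'; last by lia.
rewrite -rkE; split; first by apply: dimvS; exact: capvSr.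
- by apply: dimvS; exact: capvSl.
rewrite -dimv_sum_cap leq_add2r; apply: dimvS; exact: subvf.
Qed.

End OrbitDimensions.

(** Crepancy reveals an exponent only where a basis exchange between adjacent blocks is possible.
    [nondegenerate] makes the first two blocks adjacent and nonempty at every vertex; the last block
    may be empty when [t i = 0], where a dimension count replaces the exchange. *)
Theorem proposition3p17 (R : realType) (m : nat) (V : nat -> vectType R[i])
    (d k t : nat -> nat) :
  let n := m.+2 in
  (forall i, 1 <= i <= n -> \dim {:V i} = d i)%N ->
  (exists phi : rep V, orbit_kt n k t phi) ->
  (forall i, 2 <= i <= n - 1 -> t i <> k i)%N ->
  let condition := exists r : nat,
    ([/\ d 1 = d n,
         forall i, 2 <= i <= n - 1 -> (d i - t i)%N = d 1
       & forall i, 1 <= i <= n - 1 -> r = (d i - k i)%N])%N in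
  let nondegenerate := ((0 < k 1 < d 1) /\
    forall i, 2 <= i <= n - 1 ->
      k i < rank2 V k t i /\ (rank2 V k t i < d i \/ t i = 0))%N in
  (nondegenerate -> (crepant m V k t <-> condition)) /\
  (condition -> crepant m V k t).
Proof.
move=> n dE [phi phiO] tk condition nondegenerate.
have vE i : (1 <= i <= n)%N -> vdim V i = d i by exact: dE.
have kd i : (1 <= i <= m.+1)%N -> (k i <= d i)%N.
  by move=> im; rewrite -vE; [exact: (orbit_k phiO) | rewrite /n; lia].
have td i : (1 <= i <= m)%N ->
    [/\ (t i.+1 <= k i.+1)%N, (t i.+1 <= d i - k i)%N
      & (d i - k i + k i.+1 <= d i.+1 + t i.+1)%N].
  by move=> im; have := orbit_t phiO im; rewrite !vE /n; [|lia|lia].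
have rank2_1 : rank2 V k t 1%N = d 1%N by rewrite /rank2 eqxx vE.
have rank2_S i : (1 <= i <= m)%N -> rank2 V k t i.+1 = (d i - k i + k i.+1 - t i.+1)%N.
  move=> im; rewrite /rank2 subn1 /= ifF; last by apply/negbTE; lia.
  by rewrite vE // /n; lia.
(* The bounds from the orbit make the truncated subtractions genuine and the flag ranks
   admissible. *)
have dims (i : 'I_m.+1) : (k i.+1 <= rank2 V k t i.+1 <= vdim V i.+1)%N.
  rewrite vE; last by have := ltn_ord i; rewrite /n; lia.
  case: i => -[|i] im /=; first by rewrite rank2_1 kd //= leqnn.
  by rewrite rank2_S //; have [] := td i.+1 im; lia.
have backward : condition -> crepant m V k t.
  move=> [r [d1n dt rE]].
  (* Here [d_{i-1} - k_{i-1} = r = d_i - k_i], so the rank of [U_{i,2}] is [d_i - t_i = d_1]. *)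
  have rk2 i : (1 <= i <= m.+1)%N -> rank2 V k t i = d 1%N.
    case: i => [|[|i]] // im; rewrite rank2_S //.
    have im2 : (2 <= i.+2 <= n - 1)%N by rewrite /n; lia.
    have im1 : (1 <= i.+1 <= n - 1)%N by rewrite /n; lia.
    have im3 : (1 <= i.+2 <= n - 1)%N by rewrite /n; lia.
    have := dt _ im2; have := rE _ im1; have := rE _ im3; have := kd _ im.
    by lia.
  apply: (crepant_of_exponents dims) => i; have im := ltn_ord i.
    rewrite /next_rank [RHS]rk2 //; case: eqP => [_|/eqP ne]; last by rewrite rk2 //; lia.
    by rewrite vE // /n /=; lia.
  case: i im => -[|i] // im' im _; rewrite /prev_corank /= !vE /n; try lia.
  by have := rE i.+1; have := rE i.+2; rewrite /n; lia.
split=> // -[/andP[k1 k1d] nd]; split=> // crep.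
have closedK : forall N (P : mpoly.mpoly N R[i]),
  (forall v, mpoly.meval v P != 0) -> forall v w, mpoly.meval v P = mpoly.meval w P.
  exact: nonvanishing_meval_cst.
have E := crepant_exponents closedK dims crep.
have exps_at i : (i <= m)%N ->
    next_rank m V k t i = rank2 V k t i.+1 /\
    ((rank2 V k t i.+1 < vdim V i.+1)%N -> prev_corank V k i = (vdim V i.+1 - k i.+1)%N).
  move=> im; apply: (E (Ordinal (im : (i < m.+1)%N))) => /=.
  case: i im => [|i] im; first by rewrite rank2_1 k1 k1d.
  (* A zero [k] would force [t = 0 = k] by [t <= k], against the assumption [t <> k]. *)
  have [kr _] := nd i.+2 im; rewrite kr andbT lt0n; apply/eqP => k0.
  by have [tk0 _ _] := td i.+1 im; apply: (tk i.+2) => //; lia.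
(* The equalities of [Q]-exponents propagate the rank [d_1] of [U_{1,2}] along the quiver; at the
   last vertex they give [d_n = d_1]. *)
have rk i : (i <= m)%N -> rank2 V k t i.+1 = d 1%N.
  elim: i => [|i IH] im //; rewrite -(IH (ltnW im)) -(exps_at i (ltnW im)).1.
  by rewrite /next_rank ltn_eqF.
have dn : d n = d 1%N.
  by rewrite -(rk m (leqnn m)) -(exps_at m (leqnn m)).1 /next_rank eqxx vE // /n; lia.
have cork i : (i <= m)%N -> (d i.+1 - k i.+1 = d 1 - k 1)%N.
  elim: i => [|i IH] im //; rewrite -(IH (ltnW im)).
  have [kr rt] := nd i.+2 im; have [td1 td2 td3] := td i.+1 im.
  (* If [U_{i,2}] is proper, the [S]-exponents give equal coranks. If it is all of [V_i] and
     [t_i = 0], the rank formula itself reads [d_{i-1} - k_{i-1} + k_i = d_i]. *)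
  case: rt => [rd|t0].
    have := (exps_at i.+1 im).2; rewrite vE; last by rewrite /n; lia.
    by rewrite /prev_corank /= vE => [/(_ rd)|]; rewrite ?/n; lia.
  have [rd|rd] := ltnP (rank2 V k t i.+2) (d i.+2).
    have := (exps_at i.+1 im).2; rewrite vE; last by rewrite /n; lia.
    by rewrite /prev_corank /= vE => [/(_ rd)|]; rewrite ?/n; lia.
  by move: rd; rewrite rank2_S // t0; lia.
(* With constant corank, the rank formula turns [rank2 = d_1] into [d_i - t_i = d_1]. *)
exists (d 1 - k 1)%N; split=> //.
  case=> [|[|i]] // im; have := rk i.+1 im; rewrite rank2_S //.
  have := cork i.+1 im; have := cork i (ltnW im); have [_ _ _] := td i.+1 im.
  by have := kd i.+2 im; lia.
case=> [|i] // im; by rewrite cork.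
Qed.
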